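(* Let $M$ be a smooth compact Riemannian manifold without boundary, let $f: M\to M$ be a $C^{1+\theta}$-expanding endomorphism, let $y\in M$, and let $\mathcal{T}$ be a family of $f$-induced $\epsilon$-tilings on $M$, where $\epsilon>0$ is sufficiently small. Then the set $$E(f,y)=\{z\in M: y\notin \overline{\{f^k(z): k\in\mathbb{N}\}}\}$$ is a winning set for modified Schmidt games induced by $f$ and played on $M$ (with respect to $\mathcal{T}$).
   Context: Here $\mathbb{N}=\{0,1,2,\dots\}$, $\mathbb{N}_+=\{1,2,\dots\}$, and $B(x,r)$ is the closed ball of center $x$ and radius $r$. A $C^{1+\theta}$-expanding endomorphism ($\theta>0$) is a $C^1$ map $f:M\to M$ with $\theta$-Hölder derivative for which there are constants $1<\sigma_1\le\sigma_2$ with $\sigma_1\|v\|\le\|D_xf v\|\le\sigma_2\|v\|$ for all $x\in M$, $v\in T_xM$. Tilings: $\epsilon>0$ is always very small (depending on $f$ and $M$). A family of $f$-induced $\epsilon$-tilings on $M$ is a family $\mathcal{T}$ of subsets $D_n^i$ of $M$ ($n=1,2,\dots$; $i=1,\dots,k_n$) such that: (1) each $D_n^i$ is open and connected and satisfies $B(f^n(x_n^i),\epsilon/2)\subset f^n(D_n^i)\subset B(f^n(x_n^i),\epsilon)$ for some $x_n^i\in D_n^i$; (2) $D_n^i\cap D_n^j=\emptyset$ for every $n$ and $i\ne j$; (3) $M=\bigcup_{i=1}^{k_n}\overline{D_n^i}$ for every $n$. Put $\mathbf{T}_n=\bigcup_{i=1}^{k_n}D_n^i$ and $\Omega=\{(z,n):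 n\ge1, z\in\mathbf{T}_n\}$. For $(z,n)\in\Omega$ let $\psi(z,n)=\overline{D_n^i}$, where $D_n^i$ is the $n$-atom containing $z$. Write $(z,n)\le(z',n')$ if $\psi(z,n)\subset\psi(z',n')$. Such a family has the following properties. There exists $a_*\in\mathbb{N}_+$ such that for any $(z,n)\in\Omega$ and any integer $m>a_*$ there is $z'\in\mathbf{T}_{m+n}$ with $(z',m+n)\le(z,n)$; fix such an $a_*$. There exist $C,\sigma>0$ with $\mathrm{diam}(\psi(z,n))\le C\exp(-\sigma n)$ for all $(z,n)\in\Omega$. Modified Schmidt games induced by $f$ on $M$ with respect to $\mathcal{T}$: fix $a,b\in\mathbb{N}_+$ both larger than $a_*$ and a target set $S\subset M$. Bob starts the $(a,b)$-game by choosing $\omega_1=(z_1,n_1)\in\Omega$. Alice then chooses $\omega_1'=(z_1',n_1')\in\Omega$ with $\psi(\omega_1')\subset\psi(\omega_1)$ and $n_1'=n_1+a$. In the $k$th turn ($k\ge2$) Bob chooses $\omega_k=(z_k,n_k)\in\Omega$ with $\psi(\omega_k)\subset\psi(\omega_{k-1}')$ and $n_k=n_{k-1}'+b$, and then Alice chooses $\omega_k'=(z_k',n_k')\in\Omega$ with $\psi(\omega_k')\subset\psi(\omega_k)$ and $n_k'=n_k+a$. The intersection of all the nested sets $\psi(\omega_1)\supset\psi(\omega_1')\supset\psi(\omega_2)\supset\cdots$ is a single point $z_\infty$. Alice wins if $z_\infty\in S$; otherwise Bob wins. $S$ is $(a,b)$-winning if Alice has a strategy to win regardless of how Bob plays;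 $S$ is $a$-winning if it is $(a,b)$-winning for every $b>a_*$; $S$ is a winning set if it is $a$-winning for some $a>a_*$. *)

(* Defs.v *)
From mathcomp Require Import all_boot all_order all_algebra.
From mathcomp Require Import all_classical all_reals all_analysis.
Import Order.TTheory GRing.Theory Num.Theory.
Import numFieldNormedType.Exports.

Set Implicit Arguments.
Unset Strict Implicit.
Unset Printing Implicit Defensive.

Local Open Scope classical_set_scope.
Local Open Scope ring_scope.

(* F is of class C^k on U; meant for open U.  For finite-dimensional V, a
   differentiable F is C^(k+1) iff all its directional derivatives are C^k. *)
Fixpoint Ck_on (R : realType) (V W : normedModType R) (k : nat)
    (U : set V) (F : V -> W) : Prop :=
  match k with
  | 0%N => {in U, continuous F}
  | k'.+1 => (forall u, U u -> differentiable F u) /\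
             (forall v : V, Ck_on k' U (fun u => 'd F u v))
  end.

Definition smooth_on (R : realType) (V W : normedModType R)
    (U : set V) (F : V -> W) : Prop :=
  forall k : nat, Ck_on k U F.

(* A homeomorphism from an open subset of M onto an open subset of R^d; the
   total functions chart_map and chart_inv are arbitrary off these sets. *)
Record chart (R : realType) (d : nat) (M : topologicalType) := Chart {
  chart_dom : set M;
  chart_map : M -> 'rV[R]_d;
  chart_inv : 'rV[R]_d -> M;
  chart_dom_open : open chart_dom;
  chart_cod_open : open (chart_map @` chart_dom);
  chart_mapK : {in chart_dom, cancel chart_map chart_inv};
  chart_map_continuous : {within chart_dom, continuous chart_map};
  chart_inv_continuous :
    {within chart_map @` chart_dom, continuous chart_inv} }.

Definition chart_cod (R : realType) (d : nat) (M : topologicalType)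
    (c : chart R d M) : set 'rV[R]_d :=
  chart_map c @` chart_dom c.

(* The expression of f : M -> M in the charts c (source) and c' (target), and
   the set where it is meaningful; for f = id, the change of charts. *)
Definition loc_rep (R : realType) (d : nat) (M : topologicalType)
    (f : M -> M) (c c' : chart R d M) : 'rV[R]_d -> 'rV[R]_d :=
  fun u => chart_map c' (f (chart_inv c u)).

Definition loc_dom (R : realType) (d : nat) (M : topologicalType)
    (f : M -> M) (c c' : chart R d M) : set 'rV[R]_d :=
  chart_map c @` (chart_dom c `&` f @^-1` chart_dom c').

(* The value at (v, w) of the bilinear form with Gram matrix A. *)
Definition gram (R : realType) (d : nat) (A : 'M[R]_d) (v w : 'rV[R]_d) : R :=
  (v *m A *m w^T) 0 0.

(* A tangent vector at x is represented, in a chart c around x, by its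
   coordinate vector v : 'rV_d; metric c u is the Gram matrix, in the
   coordinates of c, of the scalar product at the point of coordinates u.
   Second countability is not a field: it follows from compactness. *)
Record riemannian_manifold (R : realType) (d : nat) (M : topologicalType) :=
  RiemannianManifold {
  atlas : set (chart R d M);
  metric : chart R d M -> 'rV[R]_d -> 'M[R]_d;
  manifold_hausdorff : hausdorff_space M;
  atlas_cover : forall x : M, exists2 c, atlas c & chart_dom c x;
  atlas_smooth : forall c c', atlas c -> atlas c' ->
    smooth_on (loc_dom id c c') (loc_rep id c c');
  metric_smooth : forall c, atlas c -> smooth_on (chart_cod c) (metric c);
  metric_symmetric : forall c u, atlas c -> chart_cod c u ->
    (metric c u)^T = metric c u;
  metric_pos : forall c u (v : 'rV[R]_d), atlas c -> chart_cod c u ->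
    v != 0 -> 0 < gram (metric c u) v v;
  metric_compat : forall c c' u (v w : 'rV[R]_d), atlas c -> atlas c' ->
    loc_dom id c c' u ->
    gram (metric c' (loc_rep id c c' u))
         ('d (loc_rep id c c') u v) ('d (loc_rep id c c') u w)
    = gram (metric c u) v w }.

Section riemannian_distance.
Context (R : realType) (d : nat) (M : topologicalType).
Context (G : riemannian_manifold R d M).

(* The norm of the tangent vector with coordinates v, in the chart c, at the
   point with coordinates u. *)
Definition tangent_norm (c : chart R d M) (u v : 'rV[R]_d) : R :=
  Num.sqrt (gram (metric G c u) v v).

(* curve_length x y L: some piecewise C^1 curve from x to y has length L.
   The curve is cut into finitely many C^1 pieces, each parametrized by [0, 1]
   and lying in the domain of one chart.  Taking the coordinate curve g to be
   C^1 on the whole line is harmless: a C^1 curve on [0, 1] extends. *)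
Inductive curve_length : M -> M -> \bar R -> Prop :=
| curve_length_nil x : curve_length x x 0%E
| curve_length_cons (x y z : M) (c : chart R d M) (g : R -> 'rV[R]_d)
    (L : \bar R) :
    atlas G c ->
    (forall t, derivable g t 1) -> continuous (derive1 g) ->
    (forall t, 0 <= t <= 1 -> chart_cod c (g t)) ->
    chart_inv c (g 0) = x -> chart_inv c (g 1) = y ->
    curve_length y z L ->
    curve_length x z
      (\int[lebesgue_measure]_(t in `[0%R, 1%R])
         (tangent_norm c (g t) (derive1 g t))%:E + L)%E.

(* +oo between distinct connected components (M need not be connected). *)
Definition riemannian_dist (x y : M) : \bar R :=
  ereal_inf [set L | curve_length x y L].

Definition riemannian_cball (x : M) (r : R) : set M :=
  [set y | (riemannian_dist x y <= r%:E)%E].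

End riemannian_distance.

Definition C1_map (R : realType) (d : nat) (M : topologicalType)
    (G : riemannian_manifold R d M) (f : M -> M) : Prop :=
  continuous f /\
  forall c c', atlas G c -> atlas G c' ->
    Ck_on 1 (loc_dom f c c') (loc_rep f c c').

(* The derivative is theta-Hoelder, locally in the charts. *)
Definition holder_derivative (R : realType) (d : nat) (M : topologicalType)
    (G : riemannian_manifold R d M) (theta : R) (f : M -> M) : Prop :=
  forall c c' u, atlas G c -> atlas G c' -> loc_dom f c c' u ->
    exists (K : R) (N : set 'rV[R]_d), nbhs u N /\
      forall p q (v : 'rV[R]_d), N p -> N q ->
        `|'d (loc_rep f c c') p v - 'd (loc_rep f c c') q v|
          <= K * `|p - q| `^ theta * `|v|.

(* In the last clause, u and v are the coordinates in c of a point x and of a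
   tangent vector at x; the middle term is the norm of its image by D_x f. *)
Definition expanding_endomorphism (R : realType) (d : nat)
    (M : topologicalType) (G : riemannian_manifold R d M) (theta : R)
    (f : M -> M) : Prop :=
  [/\ C1_map G f, holder_derivative G theta f &
    exists s1 s2 : R, [/\ 1 < s1, s1 <= s2 &
      forall c c' u (v : 'rV[R]_d), atlas G c -> atlas G c' ->
        loc_dom f c c' u ->
        s1 * tangent_norm G c u v
          <= tangent_norm G c' (loc_rep f c c' u) ('d (loc_rep f c c') u v)
          <= s2 * tangent_norm G c u v]].

(* The atoms of index n = 0 are irrelevant. *)
Record tiling (R : realType) (d : nat) (M : topologicalType)
    (G : riemannian_manifold R d M) (f : M -> M) (eps : R) := Tiling {
  natoms : nat -> nat;
  atom : forall n : nat, 'I_(natoms n) -> set M;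
  atom_open : forall n (i : 'I_(natoms n)), (0 < n)%N -> open (atom i);
  atom_connected : forall n (i : 'I_(natoms n)), (0 < n)%N ->
    connected (atom i);
  atom_ball : forall n (i : 'I_(natoms n)), (0 < n)%N ->
    exists2 x, atom i x &
      riemannian_cball G (iter n f x) (eps / 2) `<=` iter n f @` atom i /\
      iter n f @` atom i `<=` riemannian_cball G (iter n f x) eps;
  atom_disjoint : forall n (i j : 'I_(natoms n)), (0 < n)%N -> i != j ->
    atom i `&` atom j = set0;
  atom_cover : forall n, (0 < n)%N ->
    \bigcup_(i in [set: 'I_(natoms n)]) closure (atom i) = [set: M] }.

Section modified_schmidt_games.
Context (R : realType) (d : nat) (M : topologicalType).
Context (G : riemannian_manifold R d M) (f : M -> M) (eps : R).
Context (T : tiling G f eps).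

Definition Omega : set (M * nat) :=
  [set w | (0 < w.2)%N /\ exists i : 'I_(natoms T w.2), atom i w.1].

(* The union has exactly one term when w is in Omega. *)
Definition psi (w : M * nat) : set M :=
  \bigcup_(i in [set i : 'I_(natoms T w.2) | atom i w.1]) closure (atom i).

Definition descending (astar : nat) : Prop :=
  forall (w : M * nat) (m : nat), Omega w -> (astar < m)%N ->
    exists z' : M, Omega (z', (m + w.2)%N) /\ psi (z', (m + w.2)%N) `<=` psi w.

(* A strategy of Alice maps the list of the moves made so far by Bob, the
   first one first, to her answer.  Moves are numbered from 0. *)
Definition strategy := seq (M * nat) -> M * nat.

Definition alice_move (s : strategy) (bob : nat -> M * nat) (k : nat) :
    M * nat :=
  s (mkseq bob k.+1).

Definition bob_legal (b : nat) (s : strategy) (bob : nat -> M * nat)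
    (k : nat) : Prop :=
  match k with
  | 0%N => Omega (bob 0%N)
  | k'.+1 => [/\ Omega (bob k), psi (bob k) `<=` psi (alice_move s bob k') &
                 (bob k).2 = ((alice_move s bob k').2 + b)%N]
  end.

Definition alice_legal (a : nat) (s : strategy) (bob : nat -> M * nat)
    (k : nat) : Prop :=
  [/\ Omega (alice_move s bob k), psi (alice_move s bob k) `<=` psi (bob k) &
      (alice_move s bob k).2 = ((bob k).2 + a)%N].

(* As the sets psi are nested, the intersection of Bob's ones is that of all
   of them. *)
Definition ab_winning (a b : nat) (S : set M) : Prop :=
  exists s : strategy, forall bob : nat -> M * nat,
    (forall k, (forall j, (j <= k)%N -> bob_legal b s bob j) ->
       alice_legal a s bob k) /\
    ((forall k, bob_legal b s bob k) ->
       exists2 z, \bigcap_k psi (bob k) = [set z] & S z).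

Definition a_winning (astar a : nat) (S : set M) : Prop :=
  forall b, (astar < b)%N -> ab_winning a b S.

Definition winning (astar : nat) (S : set M) : Prop :=
  exists2 a, (astar < a)%N & a_winning astar a S.

End modified_schmidt_games.

Definition nondense_set (M : topologicalType) (f : M -> M) (y : M) : set M :=
  [set z | ~ closure [set iter k f z | k in [set: nat]] y].

(* Main.v *)
Require Import Defs.
From mathcomp Require Import all_boot all_order all_algebra.
From mathcomp Require Import finmap zify ring lra.
From mathcomp Require Import all_classical all_reals all_analysis.
From mathcomp Require Import measurable_realfun.
Import Order.TTheory GRing.Theory Num.Theory.
Import numFieldNormedType.Exports.

Set Implicit Arguments.
Unset Strict Implicit.
Unset Printing Implicit Defensive.

Local Open Scope classical_set_scope.
Local Open Scope ring_scope.

(* Reading the Riemannian metric in finitely many charts gives a gauge which f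
   expands by a factor > 1 on close points, so that points whose orbits stay
   close are equal. Since atoms are connected and f^n maps an atom of level n
   into a small ball, induction on n (close points of the atom are very close,
   hence all points are) shows that all orbit segments of length n starting in
   the closure of the atom stay close to each other: f^n is injective there,
   and the image by f^(n-j) is exponentially small in j. Consequently, for a
   large, every atom of level n contains two atoms of level n + a whose images
   by f^n are uniformly far apart.

   A time i is dangerous for a position P if f^i maps some point of P near y.
   As f^(n-i) is continuous at y, a given dangerous time i close to n cannot
   remain dangerous for both of these subatoms; so with a suitable choice
   Alice halves the number of dangerous times. She plays by blocks of r turns,
   handling in each block the r (a + b) times of the preceding one (in the
   first block, the n1 + 1 times up to the level n1 of Bob's first move), with
   2^r > n1 + 1 + r (a + b): at the end of the block none is dangerous. *)

(** * Neighborhoods of the diagonal *)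

(** Neighborhoods of the diagonal: on a compact Hausdorff space, the entourages of its unique
    uniformity. They express closeness on [M], which carries a topology only. *)
Definition near_diag (M : topologicalType) (V : M -> M -> Prop) : Prop :=
  forall x : M, exists2 N, nbhs x N & forall p q, N p -> N q -> V p q.

Section near_diagonal.
Context (R : realType) (M : topologicalType).
Implicit Types (V W : M -> M -> Prop) (x p q : M).

Lemma near_diagP V :
  (forall x, nbhs (x, x) [set z | V z.1 z.2]) -> near_diag V.
Proof.
move=> nV x; have [[A B] /= [xA xB] AB] := nV x.
exists (A `&` B) => [|p q [Ap _] [_ Bq]]; first exact: filterI.
by apply: (AB (p, q)).
Qed.

Lemma near_diag_refl V p : near_diag V -> V p p.
Proof. by move=> /(_ p)[N /nbhs_singleton Np]; apply. Qed.

Lemma near_diagI V W :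
  near_diag V -> near_diag W -> near_diag (fun p q => V p q /\ W p q).
Proof.
move=> nV nW x; have [N1 N1x NV] := nV x; have [N2 N2x NW] := nW x.
by exists (N1 `&` N2) => [|p q [? ?] [? ?]]; [exact: filterI|split; auto].
Qed.

Lemma near_diagS V W :
  (forall p q, V p q -> W p q) -> near_diag V -> near_diag W.
Proof. by move=> VW nV x; have [N Nx NV] := nV x; exists N => // *; auto. Qed.

Lemma near_diag_sym V : near_diag V -> near_diag (fun p q => V q p).
Proof. by move=> nV x; have [N Nx NV] := nV x; exists N => // *; auto. Qed.

Lemma near_diag_nbhs V p : near_diag V -> nbhs p (V p).
Proof.
move=> /(_ p)[N pN NV]; apply: (filterS _ pN) => q; apply: NV.
exact: nbhs_singleton pN.
Qed.

Lemma near_diag_nbhs_sym V q : near_diag V -> nbhs q (V^~ q).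
Proof. by move=> /near_diag_sym /near_diag_nbhs. Qed.

Lemma near_diag_comp (f : M -> M) V : continuous f -> near_diag V ->
  near_diag (fun p q => V (f p) (f q)).
Proof.
move=> cf nV x; have [N Nx NV] := nV (f x).
by exists (f @^-1` N) => [|p q Np Nq]; [exact: cf|exact: NV].
Qed.

Lemma near_diag_iter (f : M -> M) V n : continuous f -> near_diag V ->
  near_diag (fun p q => forall k, (k <= n)%N -> V (iter k f p) (iter k f q)).
Proof.
move=> cf; elim: n => [|n IHn] nV.
  by apply: near_diagS nV => p q Vpq [|].
have := near_diagI nV (near_diag_comp cf (IHn nV)).
apply: near_diagS => p q [Vpq IH] [//|k] kn.
by rewrite !iterSr; exact: IH.
Qed.

Context (cM : compact [set: M]).

(** The Lebesgue number argument: radii found locally are made uniform by compactness, applied along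
    radii tending to 0 from above. *)
Lemma compact_uniform (P : R -> M -> Prop) :
  (forall e e' p, e' <= e -> P e p -> P e' p) ->
  (forall x, exists N e, [/\ nbhs x N, 0 < e & forall p, N p -> P e p]) ->
  exists2 e, 0 < e & forall p, P e p.
Proof.
move=> Pmono Ploc.
have /compact_near_coveringP/(_ _ (0^'+)%R P) := cM.
case=> [x _|e e0 eP].
  have [N [e [Nx e0 NP]]] := Ploc x.
  exists (N, [set e' | e' <= e]); first split => //=.
    exists e => //= y /=; rewrite sub0r normrN => + y0.
    by rewrite gtr0_norm // => /ltW.
  by move=> [p e'] [/= Np e'e]; apply: Pmono e'e _; exact: NP.
exists (e / 2); first by rewrite divr_gt0.
move=> p; apply: eP => //=; last by rewrite divr_gt0.
by rewrite sub0r normrN gtr0_norm ?divr_gt0// ltr_pdivrMr// ltr_pMr// ltr1n.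
Qed.

(* [B p e] plays the role of the closed ball of center p and radius e. *)
Context (B : M -> R -> set M).
Context (B_mono : forall p e e', e' <= e -> B p e' `<=` B p e).
Context (B_small : forall x N, nbhs x N -> exists N' e,
  [/\ nbhs x N', 0 < e & forall p, N' p -> B p e `<=` N]).
Context (B_large : forall e, 0 < e -> near_diag (fun p q => B p e q)).

Lemma near_diag_ball V : near_diag V ->
  exists2 e, 0 < e & forall p q, B p e q -> V p q.
Proof.
move=> nV; apply: (@compact_uniform (fun e p => forall q, B p e q -> V p q)).
  by move=> e e' p ee' PV q Bq; apply: PV; apply: B_mono ee' _ _.
move=> x; have [N Nx NV] := nV x.
have [N' [e [N'x e0 N'B]]] := B_small Nx.
exists (N `&` N'), e; split=> //; first exact: filterI.
by move=> p [Np N'p] q Bpq; apply: NV => //; exact: N'B Bpq.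
Qed.

(** No triangle inequality is assumed of [B]: around each point it is replaced by [B_small], used
    twice. Nor is [B] symmetric, so [W] asks for both memberships. *)
Lemma near_diag_half V : near_diag V -> exists W, [/\ near_diag W,
  forall p q, W p q -> W q p &
  forall p q r, W p q -> W q r -> V p r].
Proof.
move=> nV.
have [] := @compact_uniform
  (fun e p => forall q r, B p e q -> B q e r -> V p r).
- move=> e e' p ee' PV q r Bq Br.
  by apply: (PV q); apply: B_mono ee' _ _.
- move=> x; have [N Nx NV] := nV x.
  have [N1 [e1 [N1x e10 N1B]]] := B_small Nx.
  have [N2 [e2 [N2x e20 N2B]]] := B_small N1x.
  exists (N `&` N2), (Num.min e1 e2); split.
  + exact: filterI.
  + by rewrite lt_min e10.
  + move=> p [Np N2p] q r Bq Br; apply: NV => //; apply: (N1B q).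
      by apply: (N2B p) => //; apply: (B_mono _ Bq); rewrite ge_min lexx orbT.
    by apply: (B_mono _ Br); rewrite ge_min lexx.
move=> e e0 eP.
exists (fun p q => B p e q /\ B q e p); split.
- by apply: near_diagI; [|apply: near_diag_sym]; exact: B_large.
- by move=> p q [].
- by move=> p q r [? _] [? _]; exact: (eP p q).
Qed.

Lemma near_diag_half3 V : near_diag V -> exists W, [/\ near_diag W,
  forall p q, W p q -> W q p, (forall p q, W p q -> V p q) &
  forall p q r s, W p q -> W q r -> W r s -> V p s].
Proof.
move=> /near_diag_half[W [nW sW WV]].
have [U [nU sU UW]] := near_diag_half nW.
have U_W p q : U p q -> W p q by move/(UW p q q); apply; exact: near_diag_refl.
exists U; split => //.
  by move=> p q /U_W Wpq; apply: (WV p q q) => //; exact: near_diag_refl.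
by move=> p q r s /UW/[apply] Wpr /U_W Wrs; exact: WV Wpr Wrs.
Qed.

(** Near [x] choose another point [y]; its complement is a neighborhood of [x], so small balls
    around the points near [x] miss [y], and compactness makes the radius uniform. *)
Lemma near_diag_apart (hM : hausdorff_space M) V : near_diag V ->
  (forall x N, nbhs x N -> exists2 y, N y & y <> x) ->
  exists2 W, near_diag W & forall p, exists2 q, V p q & ~ W p q.
Proof.
move=> nV noiso.
have [] := @compact_uniform (fun e p => exists2 q, V p q & ~ B p e q).
- by move=> e e' p ee' [q Vq nBq]; exists q => // /(B_mono ee').
- move=> x; have [N Nx NV] := nV x.
  have [y Ny yx] := noiso x N Nx.
  have xny : nbhs x (~` [set y]).
    apply: open_nbhs_nbhs; split; last by move=> /= /esym.
    apply: closed_openC; apply: accessible_closed_set1.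
    exact: hausdorff_accessible.
  have [N' [e [N'x e0 N'B]]] := B_small xny.
  exists (N `&` N'), e; split=> //; first exact: filterI.
  move=> p [Np N'p]; exists y; first exact: NV.
  by move=> Bpy; exact: (N'B _ N'p _ Bpy).
move=> e e0 eP; exists (fun p q => B p e q); first exact: B_large.
exact: eP.
Qed.

End near_diagonal.

(** * Locally expanded gauges *)

Section expanding_gauge.
Context (R : realType) (M : topologicalType) (f : M -> M) (cf : continuous f).
Context (V0 : M -> M -> Prop) (delta : M -> M -> R) (mu : R).
Context (mu1 : 1 < mu) (nV0 : near_diag V0).
Context (V0_expand :
  forall p q, V0 p q -> mu * delta p q <= delta (f p) (f q)).
Context (V0_le1 : forall p q, V0 p q -> delta p q <= 1).
Context (delta_refl : forall p, delta p p = 0).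
Context (V0_sep : forall p q, V0 p q -> delta p q <= 0 -> p = q).
Context (V0_small : forall W, near_diag W ->
  exists2 e, 0 < e & forall p q, V0 p q -> delta p q <= e -> W p q).
Context (delta_small : forall e, 0 < e -> near_diag (fun p q => delta p q <= e)).

Lemma continuous_iter n : continuous (iter n f).
Proof.
elim: n => [|n IHn] x; first exact: cvg_id.
by apply: continuous_comp (IHn x) _; exact: cf.
Qed.

Let mu0 : 0 < mu. Proof. exact: lt_trans mu1. Qed.

(** [q] lies in the Bowen ball of order [n] around [p], with [V0] in place of a radius; time [n] is
    included. *)
Definition shadow n p q := forall j, (j <= n)%N -> V0 (iter j f p) (iter j f q).

Lemma shadow_expand n p q : shadow n p q ->
  mu ^+ n * delta p q <= delta (iter n f p) (iter n f q).
Proof.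
elim: n => [|n IHn] sh; first by rewrite mul1r.
rewrite exprS -mulrA; apply: le_trans _ (V0_expand (sh n (leqnSn n))).
by apply: ler_wpM2l; [exact: ltW|apply: IHn => j jn; apply: sh; exact: leqW].
Qed.

Lemma shadow_inj n p q : shadow n p q -> iter n f p = iter n f q -> p = q.
Proof.
move=> sh pq; have := shadow_expand sh; rewrite pq delta_refl.
rewrite pmulr_rle0 ?exprn_gt0//; exact: V0_sep (sh 0%N (leq0n n)).
Qed.

Lemma expr_unbounded (e : R) : 0 < e -> exists n, 1 <= mu ^+ n * e.
Proof.
move=> e0.
have bern n : 1 + n%:R * (mu - 1) <= mu ^+ n.
  elim: n => [|n IHn]; first by rewrite mul0r addr0.
  rewrite exprS; apply: le_trans _ (ler_wpM2l (ltW mu0) IHn).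
  have : 0 <= n%:R * ((mu - 1) * (mu - 1)) by rewrite mulr_ge0// -expr2 sqr_ge0.
  rewrite -natr1; lra.
have [n en] : exists n, (e * (mu - 1))^-1 <= n%:R.
  by exists (Num.truncn (e * (mu - 1))^-1).+1; exact/ltW/truncnS_gt.
exists n; have e1 : 0 < e * (mu - 1) by rewrite mulr_gt0// subr_gt0.
have {}en : 1 <= n%:R * (e * (mu - 1)) by rewrite -ler_pdivrMr// mul1r.
apply: (@le_trans _ _ ((1 + n%:R * (mu - 1)) * e)); last by rewrite ler_pM2r.
by apply: le_trans en _; lra.
Qed.

(** The gauge is at most 1 at time [n] after an expansion by [mu ^+ n], so it was at most [e] at
    time 0. *)
Lemma shadow_small W : near_diag W ->
  exists n, forall p q, shadow n p q -> W p q.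
Proof.
move=> /V0_small[e e0 eW]; have [n en] := expr_unbounded e0.
exists n => p q sh; apply: eW; first exact: (sh 0%N).
have := shadow_expand sh => /le_trans/(_ (V0_le1 (sh n (leqnn n)))).
by move=> /le_trans/(_ en); rewrite ler_pM2l// exprn_gt0.
Qed.

(** Expansivity: a positive gauge would eventually exceed its bound 1. *)
Lemma shadow_eq p q : (forall n, V0 (iter n f p) (iter n f q)) -> p = q.
Proof.
move=> sh; apply: V0_sep; first exact: (sh 0%N).
rewrite leNgt; apply/negP => d0.
have [n] := expr_unbounded (divr_gt0 d0 (ltr0n R 2)).
have /shadow_expand/le_trans/(_ (V0_le1 (sh n))) : shadow n p q by move=> j _.
rewrite mulrA; set x := mu ^+ n * _; lra.
Qed.

(* The points of a connected set whose images are close are either close or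
   far apart, hence all close by connectedness: no inverse branch of [f] is
   needed. *)
Lemma connected_shadow V1 e (D : set M) n :
  near_diag V1 -> (forall p q r, V1 p q -> V1 q r -> V0 p r) ->
  (forall p q, V0 p q -> delta p q <= e -> V1 p q) -> 0 < e ->
  connected D ->
  (forall p q, D p -> D q -> V1 (iter n f p) (iter n f q) /\
                            delta (iter n f p) (iter n f q) <= e) ->
  forall p q j, D p -> D q -> (j <= n)%N ->
  V1 (iter j f p) (iter j f q) /\ delta (iter j f p) (iter j f q) <= e.
Proof.
move=> nV1 V1V0 eV1 e0; elim: n D => [|n IHn] D cD Dn p q j Dp Dq.
  by rewrite leqn0 => /eqP ->; exact: Dn.
have cfD : connected (f @` D).
  apply: connected_continuous_connected => //.
  exact: continuous_subspaceT.
have {}IHn p' q' i : D p' -> D q' -> (i <= n)%N ->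
    V1 (iter i.+1 f p') (iter i.+1 f q') /\
    delta (iter i.+1 f p') (iter i.+1 f q') <= e.
  move=> Dp' Dq' ni; rewrite !iterSr; apply: (IHn (f @` D)) ni => //.
  by move=> _ _ [x Dx <-] [y Dy <-]; rewrite -!iterSr; exact: Dn.
case: j => [_|j]; last by rewrite ltnS => jn; exact: IHn.
(* Closeness improves itself: the images have gauge at most [e], and expansion pulls this bound back
   to [x] and [y]. *)
have V0e x y : D x -> D y -> V0 x y -> delta x y <= e.
  move=> Dx Dy xy; have [_] := IHn x y 0%N Dx Dy isT.
  move: (V0_expand xy) => /= /le_trans/[apply].
  move: (delta x y) => z mz; have [//|ez] := lerP z e.
  have : z <= mu * z by rewrite ler_peMl// ?ltW// (lt_trans e0).
  lra.
suff : V0 p q by move=> Vpq; split; [apply: eV1|]; rewrite //=; exact: V0e.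
(* [E] is relatively open and closed in [D]: on [D], [V0]-closeness improves to [V1]-closeness,
   which leaves room for one more [V1]-step. *)
pose E := [set x | D x /\ V0 p x].
suff ED : E = D by have [] : E q by rewrite ED.
apply: cD.
- by exists p; split => //; exact: near_diag_refl.
- exists (interior (V0 p)); first exact: open_interior.
  rewrite predeqE => x; split=> [[Dx px]|[Dx /nbhs_singleton px]]//.
  split => //; have V1px : V1 p x by apply: eV1 => //; exact: V0e.
  have : nbhs x (V1 x) by exact: near_diag_nbhs.
  by apply: filterS => y; exact: V1V0.
- exists (closure E); first exact: closed_closure.
  rewrite predeqE => x; split=> [Ex|[Dx clx]].
    by split; [case: Ex|exact: subset_closure].
  split=> //; have [y [[Dy py] yx]] := clx _ (near_diag_nbhs_sym x nV1).
  by apply: V1V0 yx; apply: eV1 => //; exact: V0e.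
Qed.

(** Each point of the closure is approximated by a point of [D] with a [V1]-close [j]-th iterate;
    passing through both approximations takes three [V1]-steps. *)
Lemma closure_shadow V1 (D : set M) n :
  near_diag V1 -> (forall p q, V1 p q -> V1 q p) ->
  (forall p q r s, V1 p q -> V1 q r -> V1 r s -> V0 p s) ->
  (forall p q j, D p -> D q -> (j <= n)%N -> V1 (iter j f p) (iter j f q)) ->
  forall p q, closure D p -> closure D q -> shadow n p q.
Proof.
move=> nV1 sV1 V1V0 V1D p q clp clq j jn.
have near_iter (x : M) : nbhs x (fun y => V1 (iter j f x) (iter j f y)).
  by apply: continuous_iter; exact: near_diag_nbhs.
have [p' [Dp' pp']] := clp _ (near_iter p).
have [q' [Dq' qq']] := clq _ (near_iter q).
by apply: (V1V0 _ (iter j f p') (iter j f q')) => //; [exact: V1D|exact: sV1].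
Qed.

Lemma small_image_shadow V1 :
  near_diag V1 -> (forall p q, V1 p q -> V1 q p) ->
  (forall p q r, V1 p q -> V1 q r -> V0 p r) ->
  (forall p q r s, V1 p q -> V1 q r -> V1 r s -> V0 p s) ->
  exists2 U, near_diag U & forall (D : set M) n, connected D ->
    (forall p q, D p -> D q -> U (iter n f p) (iter n f q)) ->
    forall p q, closure D p -> closure D q -> shadow n p q.
Proof.
move=> nV1 sV1 V1V0 V1V0'; have [e e0 eV1] := V0_small nV1.
exists (fun p q => V1 p q /\ delta p q <= e).
  by apply: near_diagI => //; exact: delta_small.
move=> D n cD DU; apply: (closure_shadow nV1 sV1 V1V0') => p q j Dp Dq jn.
by have [] := connected_shadow nV1 V1V0 eV1 e0 cD DU Dp Dq jn.
Qed.

End expanding_gauge.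

(** * The game *)

Section tilings.
Context (R : realType) (d : nat) (M : topologicalType).
Context (G : riemannian_manifold R d M) (f : M -> M) (eps : R).
Context (T : tiling G f eps).

Lemma psi_atom n (i : 'I_(natoms T n)) z :
  (0 < n)%N -> atom i z -> psi T (z, n) = closure (atom i).
Proof.
move=> n0 iz; rewrite /psi predeqE => x; split=> [[j /= jz]|xi]; last by exists i.
have [->//|ij] := eqVneq i j.
by have := atom_disjoint n0 ij; rewrite -subset0 => /(_ z)[].
Qed.

Lemma Omega_psi w : Omega T w -> (0 < w.2)%N /\
  exists i : 'I_(natoms T w.2), atom i w.1 /\ psi T w = closure (atom i).
Proof.
case: w => z n [/= n0 [i iz]]; split => //; exists i; split => //.
exact: psi_atom.
Qed.

Lemma closed_psi w : Omega T w -> closed (psi T w).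
Proof. by move=> /Omega_psi[_ [i [_ ->]]]; exact: closed_closure. Qed.

Lemma psi_self w : Omega T w -> psi T w w.1.
Proof. by move=> /Omega_psi[_ [i [iw ->]]]; exact: subset_closure. Qed.

Context (V0 : M -> M -> Prop).
Context (cf : continuous f) (cM : compact [set: M]) (hM : hausdorff_space M).
Context (noiso : forall (x : M) N, nbhs x N -> exists2 y, N y & y <> x).
Context (B_small : forall (x : M) N, nbhs x N -> exists N' e,
  [/\ nbhs x N', 0 < e & forall p, N' p -> riemannian_cball G p e `<=` N]).
Context (B_large : forall e, 0 < e ->
  near_diag (fun p q => riemannian_cball G p e q)).
Context (V0_inj : forall n p q,
  shadow f V0 n p q -> iter n f p = iter n f q -> p = q).
Context (V0_small : forall W, near_diag W ->
  exists n, forall p q, shadow f V0 n p q -> W p q).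
Context (V0_eq : forall p q,
  (forall n, V0 (iter n f p) (iter n f q)) -> p = q).
Context (atom_shadow : forall n (i : 'I_(natoms T n)) p q, (0 < n)%N ->
  closure (atom i) p -> closure (atom i) q -> shadow f V0 n p q).
Context (eps0 : 0 < eps).

Let B_mono : forall (p : M) (e e' : R), e' <= e ->
  riemannian_cball G p e' `<=` riemannian_cball G p e.
Proof. by move=> p e e' ee' q /= /le_trans; apply; rewrite lee_fin. Qed.

(** [E] cannot cross the boundary of the atom: there [f^n] would take a value that it also takes
    inside, against its injectivity on the closure. So the trace of the atom on [E] is open and
    closed. *)
Lemma connected_sub_atom n (i : 'I_(natoms T n)) (E : set M) : (0 < n)%N ->
  connected E -> E `&` atom i !=set0 ->
  (forall q, E q -> (iter n f @` atom i) (iter n f q)) -> E `<=` atom i.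
Proof.
move=> n0 cE [x Eix] fE.
suff <- : E `&` atom i = E by move=> q [].
apply: cE; first by exists x.
  by exists (atom i) => //; exact: atom_open.
exists (closure (atom i)); first exact: closed_closure.
rewrite predeqE => q; split=> [[Eq iq]|[Eq iq]].
  by split => //; exact: subset_closure.
split => //; have [q' iq' q'q] := fE q Eq.
rewrite -(@V0_inj n q' q)//; apply: (atom_shadow n0 _ iq).
exact: subset_closure.
Qed.

(** The closures of the two subatoms contain the center [x] of the atom and a point [x'],
    respectively. The images of [x] and [x'] are close enough for the subatoms to stay inside the
    atom, and too far apart for the small images of the subatoms to come near each other. *)
Lemma separated_subatoms : exists (a0 : nat) (W : M -> M -> Prop),
  near_diag W /\ forall a n (i : 'I_(natoms T n)), (a0 <= a)%N -> (0 < n)%N ->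
  exists i1 i2 : 'I_(natoms T (n + a)),
    [/\ closure (atom i1) `<=` atom i, closure (atom i2) `<=` atom i &
    forall p1 p2, closure (atom i1) p1 -> closure (atom i2) p2 ->
      ~ W (iter n f p1) (iter n f p2)].
Proof.
have e20 : 0 < eps / 2 by rewrite divr_gt0.
(* Two [H]-steps from the image of the center stay in the ball covered by the image of the atom: one
   to reach the subatom, one for its size. *)
have [H [nH sH HB]] := near_diag_half cM B_mono B_small B_large (B_large e20).
have [N nN HN] := near_diag_apart cM B_mono B_small B_large hM nH noiso.
(* If the two subatoms had [W]-close image points, three [W]-steps would join the images of [x] and
   [x'], which are not [N]-close. *)
have [W [nW sW WN W3N]] := near_diag_half3 cM B_mono B_small B_large nN.
have [a0 a0W] := V0_small (near_diagI nW nH).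
exists a0, W; split=> // a n i a0a n0.
have na0 : (0 < n + a)%N by rewrite addn_gt0 n0.
have small (j : 'I_(natoms T (n + a))) p q :
    closure (atom j) p -> closure (atom j) q ->
    W (iter n f p) (iter n f q) /\ H (iter n f p) (iter n f q).
  move=> jp jq; apply: a0W => k ka; rewrite -!iterD.
  apply: (atom_shadow na0 jp jq); rewrite addnC leq_add2l.
  exact: leq_trans a0a.
have [x ix [xB _]] := atom_ball i n0.
have [w' Hw' Nw'] := HN (iter n f x).
have HHB p : H (iter n f x) p -> (iter n f @` atom i) p.
  by move=> Hp; apply/xB/(HB _ p) => //; exact: near_diag_refl.
have [x' ix' x'w'] := HHB _ Hw'; subst w'.
have cover p : exists j : 'I_(natoms T (n + a)), closure (atom j) p.
  have : [set: M] p by [].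
  by rewrite -(atom_cover T na0) => -[j _ jp]; exists j.
have sub x1 (j : 'I_(natoms T (n + a))) : atom i x1 -> closure (atom j) x1 ->
    H (iter n f x) (iter n f x1) -> closure (atom j) `<=` atom i.
  move=> ix1 jx1 Hx1; apply: connected_sub_atom => //.
  - exact/connected_closure/atom_connected.
  - by exists x1.
  - move=> q jq; apply: xB; apply: HB Hx1 _.
    by have [] := small j x1 q jx1 jq.
have [i1 i1x] := cover x; have [i2 i2x'] := cover x'.
exists i1, i2; split.
- by apply: sub i1x _ => //; exact: near_diag_refl.
- exact: sub i2x' _.
- move=> p1 p2 ip1 ip2 Wp; apply: Nw'.
  have [Wp1 _] := small i1 x p1 i1x ip1.
  have [Wp2 _] := small i2 p2 x' ip2 i2x'.
  exact: W3N Wp1 Wp Wp2.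
Qed.

(** Time [i] is dangerous for the position [P]; [Y] stands for the chosen neighborhood of [y]. *)
Definition visits (Y P : set M) (i : nat) : bool :=
  `[< exists2 z, P z & Y (iter i f z) >].

Lemma visitsS (Y P Q : set M) i : P `<=` Q -> visits Y P i -> visits Y Q i.
Proof. by move=> PQ /asboolP[z Pz Yz]; apply/asboolP; exists z; auto. Qed.

Definition halving_move (Y : set M) (I : seq nat) (a : nat) (w : M * nat)
    (z' : M) : Prop :=
  [/\ Omega T (z', w.2 + a)%N, psi T (z', w.2 + a)%N `<=` psi T w &
  (2 * count (visits Y (psi T (z', w.2 + a)%N)) I
     <= count (visits Y (psi T w)) I)%N].

Lemma count_disjoint_le (X : Type) (p1 p2 q : pred X) (s : seq X) :
  (forall x, p1 x -> q x) -> (forall x, p2 x -> q x) ->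
  (forall x, p1 x -> p2 x -> false) ->
  (count p1 s + count p2 s <= count q s)%N.
Proof.
move=> p1q p2q p12; elim: s => //= x s IHs; rewrite addnACA leq_add//.
move: (p1q x) (p2q x) (p12 x).
case: (p1 x) => [/(_ isT) -> _|_ + _]; case: (p2 x) => //.
  by move=> /(_ isT isT).
by move=> /(_ isT) ->.
Qed.

(** A time [i] dangerous for both subatoms gives two points of [Y] whose iterates of order
    [w.2 - i], at most [L], are [W]-close, against the separation. So the two counts add up to at
    most the old one, and the smaller is at most half of it. *)
Lemma exists_halving_move (a : nat) (W : M -> M -> Prop) (Y : set M) (L : nat)
    (I : seq nat) (w : M * nat) :
  (forall n (i : 'I_(natoms T n)), (0 < n)%N ->
    exists i1 i2 : 'I_(natoms T (n + a)),
    [/\ closure (atom i1) `<=` atom i, closure (atom i2) `<=` atom i &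
    forall p1 p2, closure (atom i1) p1 -> closure (atom i2) p2 ->
      ~ W (iter n f p1) (iter n f p2)]) ->
  (forall k u v, (k <= L)%N -> Y u -> Y v -> W (iter k f u) (iter k f v)) ->
  Omega T w -> {in I, forall i, (i <= w.2 <= i + L)%N} ->
  exists z', halving_move Y I a w z'.
Proof.
move=> aW YW /Omega_psi[n0 [i [iw wi]]] IL.
have [i1 [i2 [i1i i2i sep]]] := aW _ i n0.
have na0 : (0 < w.2 + a)%N by rewrite addn_gt0 n0.
have [z1 iz1 _] := atom_ball i1 na0.
have [z2 iz2 _] := atom_ball i2 na0.
have psi1 := psi_atom na0 iz1; have psi2 := psi_atom na0 iz2.
have ciw : atom i `<=` psi T w by rewrite wi; exact: subset_closure.
have : (count (visits Y (closure (atom i1))) I +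
    count (visits Y (closure (atom i2))) I <= count (visits Y (psi T w)) I)%N.
  pose p1 := [pred j | (j \in I) && visits Y (closure (atom i1)) j].
  pose p2 := [pred j | (j \in I) && visits Y (closure (atom i2)) j].
  rewrite -(@eq_in_count _ p1 (visits Y (closure (atom i1)))) ; last first.
    by move=> j jI; rewrite /= jI.
  rewrite -(@eq_in_count _ p2 (visits Y (closure (atom i2)))); last first.
    by move=> j jI; rewrite /= jI.
  apply: count_disjoint_le => j /=.
  - by move=> /andP[_]; apply: visitsS => p /i1i /ciw.
  - by move=> /andP[_]; apply: visitsS => p /i2i /ciw.
  - move=> /andP[jI /asboolP[p1' ip1 Yp1]] /andP[_ /asboolP[p2' ip2 Yp2]].
    exfalso; apply: (sep _ _ ip1 ip2).
    have /andP[jn nL] := IL _ jI.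
    rewrite -(subnK jn) !iterD; apply: YW => //.
    by rewrite leq_subLR.
move: (leq_total (count (visits Y (closure (atom i1))) I)
  (count (visits Y (closure (atom i2))) I)).
case/orP => le12 le.
- exists z1; split; first by split => //; exists i1.
    by rewrite psi1; exact: subset_trans _ ciw.
  by rewrite psi1 mul2n -addnn; apply: leq_trans le; rewrite leq_add2l.
- exists z2; split; first by split => //; exists i2.
    by rewrite psi2; exact: subset_trans _ ciw.
  by rewrite psi2 mul2n -addnn; apply: leq_trans le; rewrite leq_add2r.
Qed.

Lemma linear_lt_exp2 (b c : nat) : exists2 r, (0 < r)%N & (b + r * c < 2 ^ r)%N.
Proof.
(* For [r = 4 s], [2 ^ r] is the square of [2 ^ (2 * s)], hence at least [(2 s + 1) ^ 2], and [s]
   exceeds both [b] and [c]. *)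
pose s := (b + c).+1; exists (2 * (2 * s))%N; first by rewrite muln_gt0.
have s2 : (2 * s < 2 ^ (2 * s))%N by exact: ltn_expl.
rewrite [X in (_ < X)%N](_ : _ = 2 ^ (2 * s) * 2 ^ (2 * s))%N; last first.
  by rewrite -expnD addnn mul2n.
apply: leq_trans (leq_mul s2 s2).
rewrite /s; nia.
Qed.

(* Bob's k-th atom has level n1 + k c with c = a + b; block m is made of the
   turns m r <= k < (m + 1) r, during which Alice takes care of the times in
   [window m], all of which are at most n1 + m r c. *)
Definition window (n1 r c m : nat) : seq nat :=
  if m is m'.+1 then iota (n1 + m' * (r * c)).+1 (r * c) else iota 0 n1.+1.

Lemma window_cover n1 r c i : (0 < r)%N -> (0 < c)%N ->
  exists m, i \in window n1 r c m.
Proof.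
move=> r0 c0; have rc0 : (0 < r * c)%N by rewrite muln_gt0 r0.
have [in1|n1i] := leqP i n1; first by exists 0%N; rewrite mem_iota.
exists ((i - n1.+1) %/ (r * c)).+1; rewrite mem_iota.
have := divn_eq (i - n1.+1) (r * c); have := ltn_pmod (i - n1.+1) rc0.
by move: (_ %/ _)%N (_ %% _)%N => q s; lia.
Qed.

Lemma size_window n1 r c m : (size (window n1 r c m) <= n1.+1 + r * c)%N.
Proof. by case: m => [|m]; rewrite size_iota ?leq_addr ?leq_addl. Qed.

(** While block [m] is played, the times of its window are past but at most two blocks old; the term
    [n1] is for the first window, which goes back to time 0. *)
Lemma window_level n1 r c m k i : (k %/ r = m)%N -> (0 < r)%N ->
  i \in window n1 r c m ->
  (i <= n1 + k * c <= i + (n1 + 2 * (r * c)))%N.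
Proof.
move=> <- r0; have := divn_eq k r; have := ltn_pmod k r0.
move: (k %/ r)%N (k %% r)%N => q s sr ->.
case: q => [|q]; rewrite /window mem_iota => /andP[i1 i2].
  by apply/andP; split; nia.
by apply/andP; split; nia.
Qed.

Lemma nested_cluster (P : nat -> set M) :
  (forall k, closed (P k)) -> (forall k, P k !=set0) ->
  (forall k, P k.+1 `<=` P k) -> (\bigcap_k P k) !=set0.
Proof.
move=> clP P0 Pn.
have PP k n : (k <= n)%N -> P n `<=` P k.
  move=> /subnK <-; elim: (n - k)%N => [//|j IHj].
  by rewrite addSn; apply: subset_trans IHj; exact: Pn.
have [x Px] := choice P0.
have [z [_ zx]] : [set: M] `&` cluster (x @ \oo) !=set0.
  by apply: cM; exact: filterT.
exists z => k _; apply: clP => N zN; apply: zx zN; exists k => //= n kn.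
exact/(PP _ _ kn)/Px.
Qed.

(** The default value also has level [w.2 + a]: the levels are thus known before the existence of a
    halving move, whose proof depends on them. *)
Definition best_reply (Y : set M) (I : seq nat) (a : nat) (w : M * nat) :
    M * nat :=
  if pselect (exists z', halving_move Y I a w z') is left h
  then (sval (cid h), w.2 + a)%N else (w.1, w.2 + a)%N.

Lemma best_reply_level Y I a w : (best_reply Y I a w).2 = (w.2 + a)%N.
Proof. by rewrite /best_reply; case: pselect. Qed.

Lemma best_replyP Y I a w : (exists z', halving_move Y I a w z') ->
  halving_move Y I a w (best_reply Y I a w).1.
Proof.
by rewrite /best_reply; case: pselect => [h _|//] /=; exact: svalP (cid h).
Qed.

Lemma winning_nondense_set (astar : nat) (y : M) :
  winning T astar (nondense_set f y).
Proof.
have [a0 [W [nW aW]]] := separated_subatoms.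
(* At least [a0] for the separation, above [astar] for the rules, and chosen before [b]. *)
pose a := (maxn a0 astar).+1.
exists a; first by rewrite ltnS leq_maxr.
have {}aW n (i : 'I_(natoms T n)) := aW a n i (leqW (leq_maxl _ _)).
move=> b _; pose c := (a + b)%N; have c0 : (0 < c)%N by [].
(* The block length depends on the level [n1] of Bob's first move, which Alice reads in the
   history. *)
have /choice[r /all_and2[r0 r2]] n1 : exists r,
    (0 < r)%N /\ (n1.+1 + r * c < 2 ^ r)%N.
  by have [r] := linear_lt_exp2 n1.+1 c; exists r.
(* The bound of [window_level] on the age of the times; [Y] is then so small that its first [L]
   iterates stay [W]-small. *)
pose L n1 := (n1 + 2 * (r n1 * c))%N.
have /choice[Y /all_and2[yY YW]] n1 : exists Y, nbhs y Y /\
    forall k u v, (k <= L n1)%N -> Y u -> Y v -> W (iter k f u) (iter k f v).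
  have [Y yY YW] := near_diag_iter (L n1) cf nW y.
  by exists Y; split => // k u v kL Yu Yv; exact: YW kL.
pose I n1 k := window n1 (r n1) c (k %/ r n1).
(* The length of the history gives the turn, hence the block. The default [(y, 0)] concerns the
   empty history only. *)
pose s (h : seq (M * nat)) : M * nat :=
  let w0 := head (y, 0%N) h in
  best_reply (Y w0.2) (I w0.2 (size h).-1) a (last w0 h).
exists s => bob; pose n1 := (bob 0%N).2.
have sE k : alice_move s bob k = best_reply (Y n1) (I n1 k) a (bob k).
  rewrite /alice_move /s size_mkseq /=; congr (best_reply _ _ _ _).
  by rewrite -[RHS](last_rcons (bob 0%N) (mkseq bob k)) -mkseqS.
have level k : (forall j, (j <= k)%N -> bob_legal T b s bob j) ->
    (bob k).2 = (n1 + k * c)%N.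
  elim: k => [|k IHk] leg; first by rewrite addn0.
  have [_ _ ->] := leg k.+1 (leqnn _).
  rewrite sE best_reply_level IHk; first by rewrite /c; lia.
  by move=> j jk; apply: leg; exact: leqW.
have Omega_bob k : bob_legal T b s bob k -> Omega T (bob k).
  by case: k => [//|k] [].
have reply k : (forall j, (j <= k)%N -> bob_legal T b s bob j) ->
    halving_move (Y n1) (I n1 k) a (bob k) (alice_move s bob k).1.
  move=> leg; rewrite sE; apply: best_replyP.
  apply: (exists_halving_move (W := W) (L := L n1)) => //.
  - exact: YW.
  - exact/Omega_bob/leg.
  - by move=> i iI; rewrite level//; apply: (window_level _ _ iI).
have alice_eta k :
    alice_move s bob k = ((alice_move s bob k).1, (bob k).2 + a)%N.
  by rewrite -(best_reply_level (Y n1) (I n1 k)) -sE; case: alice_move.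
split.
  by move=> k /reply[]; rewrite -alice_eta => ? ? _; split => //;
    rewrite sE best_reply_level.
move=> leg; pose P k := psi T (bob k).
have PA k : P k.+1 `<=` psi T (alice_move s bob k) by have [] := leg k.+1.
have PS k : P k.+1 `<=` P k.
  have [_] := reply k (fun j _ => leg j).
  by rewrite -alice_eta => /(subset_trans (PA k)).
have half k : (2 * count (visits (Y n1) (P k.+1)) (I n1 k)
    <= count (visits (Y n1) (P k)) (I n1 k))%N.
  have [_ _] := reply k (fun j _ => leg j); rewrite -alice_eta.
  apply: leq_trans; rewrite leq_mul2l /=.
  by apply: sub_count => i; apply: visitsS; exact: PA.
have [z Pz] : (\bigcap_k P k) !=set0.
  apply: nested_cluster => // k; first exact/closed_psi/Omega_bob.
  by exists (bob k).1; apply/psi_self/Omega_bob.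
exists z.
  (* For every [n], two points of the intersection share a closed atom of level at least [n], so
     their orbits stay close up to time [n]. *)
  rewrite eqEsubset; split => [x Px|_ -> //]; apply: V0_eq => n.
  have [n0 [i [_ wi]]] := Omega_psi (Omega_bob _ (leg n)).
  have cl t : (\bigcap_k P k) t -> closure (atom i) t by rewrite -wi; apply.
  apply: (atom_shadow n0 (cl x Px) (cl z Pz)).
  by rewrite level// /c; nia.
(* If [y] were in the closure of the orbit of [z], some [f^i z] would fall in [Y]; as [z] lies in
   every position, time [i] would remain dangerous forever. *)
move=> /(_ _ (yY n1))[_ [[i _ <-] Yi]].
have [m im] := window_cover n1 i (r0 n1) c0.
have vis k : visits (Y n1) (P k) i by apply/asboolP; exists z => //; exact: Pz.
(* The [r] turns of block [m] each halve the count of its window, which ends below 1 and thus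
   excludes [i]. *)
suff : (2 ^ r n1 *
    count (visits (Y n1) (P (m * r n1 + r n1)%N)) (window n1 (r n1) c m)
    <= size (window n1 (r n1) c m))%N.
  move=> /leq_trans/(_ (size_window _ _ _ _))/leq_ltn_trans/(_ (r2 n1)).
  rewrite -[X in (_ < X)%N]muln1 ltn_pmul2l ?expn_gt0// ltnS leqn0.
  by rewrite -leqn0 leqNgt -has_count => /hasP; apply; exists i.
have : (r n1 <= r n1)%N by [].
(* Induction on the number [t] of turns played in the block; the block length stays fixed in its
   start [m * r n1] and in the window. *)
move: {1 3 5}(r n1) => t; elim: t => [_|t IHt tr].
  by rewrite mul1n count_size.
apply: leq_trans (IHt (ltnW tr)).
rewrite expnSr -mulnA leq_mul2l addnS; apply/orP; right.
have := half (m * r n1 + t)%N.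
by rewrite /I divnMDl ?r0// divn_small// addn0.
Qed.

End tilings.

(** * Scalar products *)

Section sup_norm.
Context (R : realType).

Lemma ler_mx_normP m n (x : 'M[R]_(m, n)) (e : R) :
  reflect (0 <= e /\ forall i j, `|x i j| <= e) (`|x| <= e).
Proof.
rewrite [ `|x|](mx_normrE x); apply: (iffP (bigmax_leP _ _ _ _)).
  by move=> [e0 xe]; split => // i j; exact: (xe (i, j)).
by move=> [e0 xe]; split.
Qed.

Lemma ler_coord_norm m n (x : 'M[R]_(m, n)) i j : `|x i j| <= `|x|.
Proof. by have /ler_mx_normP[] := lexx `|x|. Qed.

End sup_norm.

Section gram.
Context (R : realType) (d : nat).
Implicit Types (A B : 'M[R]_d) (v w : 'rV[R]_d).

Lemma gramE A v w : gram A v w = \sum_i \sum_j v 0 i * A i j * w 0 j.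
Proof.
rewrite /gram mxE exchange_big; apply: eq_bigr => j _.
by rewrite mxE mulr_suml; apply: eq_bigr => i _; rewrite !mxE.
Qed.

(** All norms are sup norms of entries; the constant counts the terms of the double sum. *)
Lemma gram_bound A v w : `|gram A v w| <= (d * d)%:R * (`|A| * `|v| * `|w|).
Proof.
rewrite gramE; apply: le_trans (ler_norm_sum _ _ _) _.
apply: (@le_trans _ _ (\sum_(i < d) \sum_(j < d) `|A| * `|v| * `|w|)).
  apply: ler_sum => i _; apply: le_trans (ler_norm_sum _ _ _) _.
  apply: ler_sum => j _; rewrite !normrM [ `|A| * _]mulrC.
  apply: ler_pM => //; last exact: ler_coord_norm.
  by apply: ler_pM => //; exact: ler_coord_norm.
by rewrite !sumr_const !card_ord -mulrnA mulr_natl.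
Qed.

Lemma gramDm A B v w : gram (A + B) v w = gram A v w + gram B v w.
Proof. by rewrite /gram mulmxDr mulmxDl mxE. Qed.

Lemma gramNm A v w : gram (- A) v w = - gram A v w.
Proof. by rewrite /gram mulmxN mulNmx mxE. Qed.

Lemma gramDl A u v w : gram A (u + v) w = gram A u w + gram A v w.
Proof. by rewrite /gram !mulmxDl mxE. Qed.

Lemma gramNl A v w : gram A (- v) w = - gram A v w.
Proof. by rewrite /gram !mulNmx mxE. Qed.

Lemma gramDr A u v w : gram A w (u + v) = gram A w u + gram A w v.
Proof. by rewrite /gram linearD/= mulmxDr mxE. Qed.

Lemma gramNr A v w : gram A w (- v) = - gram A w v.
Proof. by rewrite /gram linearN/= mulmxN mxE. Qed.

Lemma gramZ A (a : R) v : gram A (a *: v) (a *: v) = a ^+ 2 * gram A v v.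
Proof.
by rewrite /gram linearZ/= -scalemxAr -!scalemxAl !mxE mulrA expr2.
Qed.

Lemma gram_0 A w : gram A 0 w = 0.
Proof. by rewrite /gram !mul0mx mxE. Qed.

Lemma gram_perturb A B v w : `|gram A v v - gram B w w| <=
  (d * d)%:R * (`|A - B| * `|v| ^+ 2 + `|B| * `|v - w| * (`|v| + `|w|)).
Proof.
have -> : gram A v v - gram B w w =
    gram (A - B) v v + (gram B (v - w) v + gram B w (v - w)).
  rewrite gramDm gramNm gramDl gramNl gramDr gramNr; ring.
apply: le_trans (ler_normD _ _) _; rewrite mulrDr lerD//.
  by rewrite expr2 [ `|A - B| * _]mulrA; exact: gram_bound.
apply: le_trans (ler_normD _ _) _; rewrite !mulrDr lerD//.
  exact: gram_bound.
by rewrite [ `|B| * _ * _]mulrAC; exact: gram_bound.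
Qed.

Lemma gram_cvg (T : Type) (F : set_system T) {FF : Filter F}
    (A : T -> 'M[R]_d) (v w : T -> 'rV[R]_d) A0 v0 w0 :
  A @ F --> A0 -> v @ F --> v0 -> w @ F --> w0 ->
  gram (A x) (v x) (w x) @[x --> F] --> gram A0 v0 w0.
Proof.
move=> cA cv cw; rewrite gramE; under eq_fun do rewrite gramE.
have coord m n (B : T -> 'M[R]_(m, n)) (B0 : 'M[R]_(m, n)) i j :
    B @ F --> B0 -> B x i j @[x --> F] --> B0 i j.
  move=> cB; exact: (cvg_comp _ _ cB (@coord_continuous R m n i j B0)).
apply: cvg_big; first exact: add_continuous.
move=> i _; apply: cvg_big; first exact: add_continuous.
by move=> j _; apply: cvgM; [apply: cvgM|]; exact: coord.
Qed.

(* By compactness of the unit sphere. *)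
Lemma gram_coercive A : (forall v, v != 0 -> 0 < gram A v v) ->
  exists2 m, 0 < m & forall v, m * `|v| ^+ 2 <= gram A v v.
Proof.
move=> Apos; pose S := [set v : 'rV[R]_d | `|v| = 1].
have [S0|] := pselect (S !=set0); last first.
  move=> S0; exists 1 => // v; have [->|v0] := eqVneq v 0.
    by rewrite gram_0 normr0 expr0n mulr0.
  exfalso; apply: S0; exists (`|v|^-1 *: v).
  by rewrite /S/= normrZ normfV normr_id mulVf// normr_eq0.
have cS : compact S.
  apply: bounded_closed_compact.
    by exists 1; split => // x x1 v /= ->; exact: ltW.
  have -> : S = (fun v : 'rV[R]_d => `|v|) @^-1` [set 1 : R] by [].
  apply: closed_comp => [v _|]; first exact: norm_continuous.
  exact: closed_eq.
have [u Su umin] := @EVT_min_rV R d (fun v => gram A v v) S S0 cS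
  (continuous_subspaceT (fun v => gram_cvg (cvg_cst A) cvg_id cvg_id)).
have u0 : u != 0.
  by rewrite -normr_eq0; move: Su; rewrite /S inE/= => ->; rewrite oner_eq0.
exists (gram A u u); first exact: Apos.
move=> v; have [->|v0] := eqVneq v 0.
  by rewrite gram_0 normr0 expr0n mulr0.
have nv0 : 0 < `|v| by rewrite normr_gt0.
have := umin (`|v|^-1 *: v); rewrite gramZ exprVn mulrC ler_pdivlMr ?exprn_gt0//.
apply; rewrite inE /S/= normrZ normfV normr_id mulVf// gt_eqF//.
Qed.

End gram.

(** * Charts and segments *)

(** The sum of [phi] and a primitive of [s] has a nonnegative derivative, so it is nondecreasing;
    the derivative of [phi] is never integrated. *)
Lemma le_integral_derive (R : realType) (s phi : R -> R) :
  (forall t, 0 <= t <= 1 -> {for t, continuous s}) ->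
  (forall t, 0 <= t <= 1 -> derivable phi t 1) ->
  (forall t, 0 <= t <= 1 -> - derive1 phi t <= s t) ->
  ((phi 0 - phi 1)%:E <= \int[lebesgue_measure]_(t in `[0%R, 1%R]) (s t)%:E)%E.
Proof.
move=> cs dphi sphi.
have in01 (t : R) : t \in `[0, 1] -> 0 <= t <= 1 by rewrite in_itv.
have cws : {within `[0, 1], continuous s}.
  by apply: continuous_in_subspaceT => t; rewrite inE => /in01 /cs.
have is01 : lebesgue_measure.-integrable `[0%R, 1%R] (EFin \o s).
  by apply: continuous_compact_integrable => //; exact: segment_compact.
pose F := fun x : R => (\int[lebesgue_measure]_(t in `[0%R, x]) s t)%R.
have F0 : F 0 = 0 by rewrite /F set_itv1 Rintegral_set1.
have oo01 (x : R) : x \in `]0, 1[ -> 0 <= x <= 1.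
  by rewrite in_itv/= => /andP[? ?]; rewrite !ltW.
have dF x : x \in `]0, 1[ -> derivable F x 1 /\ derive1 F x = s x.
  move=> x01; have /andP[x0 x1] : 0 < x < 1 by move: x01; rewrite in_itv.
  by apply: (@continuous_FTC1_closed _ s 0 x 1 x1 is01 x0); exact/cs/oo01.
have : F 0 + phi 0 <= F 1 + phi 1.
  apply: (@ger0_derive1_le_cc R (F \+ phi) 0 1).
  - move=> x x01; apply: derivableD; first by have [] := dF x x01.
    exact/dphi/oo01.
  - move=> x x01; have [dFx Fx] := dF x x01; have x1 := oo01 x x01.
    rewrite derive1E deriveD//; last exact: dphi.
    by rewrite -!derive1E Fx -lerBlDr sub0r; exact: sphi.
  - move=> x; apply: continuousD.
      exact: (parameterized_integral_continuous ler01 is01).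
    move: x; apply: continuous_in_subspaceT => t.
    rewrite inE => /in01 /dphi /derivable1_diffP; exact: differentiable_continuous.
  - by rewrite in_itv/= lexx ler01.
  - by rewrite in_itv/= lexx ler01.
  - exact: ler01.
rewrite F0 add0r -lerBlDr => le01.
rewrite -[leRHS]fineK; last exact: (integrable_fin_num _ is01).
by rewrite lee_fin.
Qed.

Section line.
Context (R : realType) (V : normedModType R) (a w : V).

Lemma is_diff_line (t : R) :
  is_diff t (fun t : R => a + t *: w) (0 + *:%R^~ w).
Proof. exact: (is_diffD (is_diff_cst a t) (is_diff_scalel t w)). Qed.

Lemma differentiable_line (t : R) : differentiable (fun t : R => a + t *: w) t.
Proof. by case: (is_diff_line t). Qed.

Lemma derive1_line (t : R) : derive1 (fun t : R => a + t *: w) t = w.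
Proof.
rewrite derive1E'; last exact: differentiable_line.
by have [_ ->] := is_diff_line t; rewrite fctE/= add0r scale1r.
Qed.

End line.

Section charts.
Context (R : realType) (d : nat) (M : topologicalType).
Implicit Types (c : chart R d M) (x : M) (u : 'rV[R]_d).

Lemma chart_cod_map c x : chart_dom c x -> chart_cod c (chart_map c x).
Proof. by exists x. Qed.

Lemma chart_mapK' c x : chart_dom c x -> chart_inv c (chart_map c x) = x.
Proof. by move=> cx; apply: chart_mapK; rewrite inE. Qed.

Lemma chart_invK c u : chart_cod c u -> chart_map c (chart_inv c u) = u.
Proof. by move=> [x cx <-]; rewrite chart_mapK'. Qed.

Lemma chart_dom_inv c u : chart_cod c u -> chart_dom c (chart_inv c u).
Proof. by move=> [x cx <-]; rewrite chart_mapK'. Qed.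

Lemma nbhs_chart_dom c x : chart_dom c x -> nbhs x (chart_dom c).
Proof.
by move=> cx; apply: open_nbhs_nbhs; split => //; exact: chart_dom_open.
Qed.

Lemma nbhs_chart_cod c u : chart_cod c u -> nbhs u (chart_cod c).
Proof.
by move=> cu; apply: open_nbhs_nbhs; split => //; exact: chart_cod_open.
Qed.

Lemma chart_map_cvg c x : chart_dom c x -> {for x, continuous (chart_map c)}.
Proof.
move=> cx; have := @chart_map_continuous _ _ _ c.
rewrite continuous_open_subspace; last exact: chart_dom_open.
by apply; rewrite inE.
Qed.

Lemma chart_inv_cvg c u : chart_cod c u -> {for u, continuous (chart_inv c)}.
Proof.
move=> cu; have := @chart_inv_continuous _ _ _ c.
rewrite continuous_open_subspace; last exact: chart_cod_open.
by apply; rewrite inE.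
Qed.

Lemma chart_ball_sub c x N : chart_dom c x -> nbhs x N ->
  exists2 r, 0 < r & forall u, `|u - chart_map c x| <= r ->
    chart_cod c u /\ N (chart_inv c u).
Proof.
move=> cx xN; have cu := chart_cod_map cx.
have : nbhs (chart_map c x) (chart_cod c `&` chart_inv c @^-1` N).
  apply: filterI; first exact: nbhs_chart_cod.
  by apply: (chart_inv_cvg cu); rewrite chart_mapK'.
move=> /nbhs_ballP[e /= e0 eN]; exists (e / 2); first by rewrite divr_gt0.
move=> u ue; apply: eN; rewrite -ball_normE /= distrC.
by apply: le_lt_trans ue _; rewrite ltr_pdivrMr// ltr_pMr// ltr1n.
Qed.

Lemma chart_near_ball c x (r : R) : chart_dom c x -> 0 < r ->
  nbhs x [set p | chart_dom c p /\ `|chart_map c p - chart_map c x| <= r].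
Proof.
move=> cx r0; apply: filterI; first exact: nbhs_chart_dom.
have /cvgrPdist_le/(_ r r0) := chart_map_cvg cx.
by apply: filterS => p /=; rewrite distrC.
Qed.

End charts.

(** * Lengths of curves and of segments in charts *)

Section riemannian.
Context (R : realType) (d : nat) (M : topologicalType).
Context (G : riemannian_manifold R d M).
Implicit Types (c : chart R d M) (x : M) (u v : 'rV[R]_d).

Lemma metric_cvg c u : atlas G c -> chart_cod c u ->
  {for u, continuous (metric G c)}.
Proof.
by move=> ac cu; have := metric_smooth ac 0; apply; rewrite inE.
Qed.

Lemma gram_ge0 c u v : atlas G c -> chart_cod c u ->
  0 <= gram (metric G c u) v v.
Proof.
move=> ac cu; have [->|v0] := eqVneq v 0; first by rewrite gram_0.
exact/ltW/metric_pos.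
Qed.

Lemma tangent_norm_sqr c u v : atlas G c -> chart_cod c u ->
  tangent_norm G c u v ^+ 2 = gram (metric G c u) v v.
Proof. by move=> ac cu; rewrite sqr_sqrtr// gram_ge0. Qed.

Lemma speed_continuous c (g : R -> 'rV[R]_d) t : atlas G c ->
  (forall t, derivable g t 1) -> continuous (derive1 g) -> chart_cod c (g t) ->
  {for t, continuous (fun t => tangent_norm G c (g t) (derive1 g t))}.
Proof.
move=> ac dg cdg ct; apply: continuous_comp (@sqrt_continuous R _).
have cg : {for t, continuous g} by exact/differentiable_continuous/derivable1_diffP.
apply: gram_cvg; [|exact: cdg|exact: cdg].
exact: continuous_comp cg (metric_cvg ac ct).
Qed.

Lemma integral_speed_le c (g : R -> 'rV[R]_d) (K : R) : atlas G c ->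
  (forall t, derivable g t 1) -> continuous (derive1 g) ->
  (forall t, 0 <= t <= 1 -> chart_cod c (g t)) ->
  (forall t, 0 <= t <= 1 -> tangent_norm G c (g t) (derive1 g t) <= K) ->
  (\int[lebesgue_measure]_(t in `[0%R, 1%R])
     (tangent_norm G c (g t) (derive1 g t))%:E <= K%:E)%E.
Proof.
move=> ac dg cdg cg gK.
have K0 : 0 <= K.
  by apply: le_trans (gK 0 _); rewrite ?lexx ?ler01// sqrtr_ge0.
apply: (@le_trans _ _
  (\int[lebesgue_measure]_(t in `[0%R, 1%R : R]) (cst K%:E t))%E).
  apply: ge0_le_integral => //=.
  - by move=> t _; rewrite lee_fin sqrtr_ge0.
  - apply/measurable_EFinP; apply: subspace_continuous_measurable_fun => //.
    apply: continuous_in_subspaceT => t; rewrite inE/= in_itv/= => t01.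
    by apply: speed_continuous => //; exact: cg.
rewrite integral_cst//.
have := @lebesgue_measure_itv R `[0%R, 1%R]; rewrite /= lte_fin ltr01 sube0.
by move=> /= ->; rewrite mule1.
Qed.

Lemma riemannian_dist_segment c p q (K : R) : atlas G c ->
  chart_dom c p -> chart_dom c q ->
  (forall t, 0 <= t <= 1 ->
    let u := chart_map c p + t *: (chart_map c q - chart_map c p) in
    chart_cod c u /\
    tangent_norm G c u (chart_map c q - chart_map c p) <= K) ->
  riemannian_cball G p K q.
Proof.
move=> ac cp cq segK; set w := chart_map c q - chart_map c p in segK *.
pose g (t : R) := chart_map c p + t *: w.
have dg t : derivable g t 1 by exact/derivable1_diffP/differentiable_line.
have g' : derive1 g = cst w by apply/funext => t; exact: derive1_line.
have := @curve_length_cons _ _ _ G p q q c g 0%E ac.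
rewrite adde0 => /(_ dg).
move=> /(_ _ _ _ _ (curve_length_nil G q)) len.
apply: (@le_trans _ _ (\int[lebesgue_measure]_(t in `[0%R, 1%R])
     (tangent_norm G c (g t) (derive1 g t))%:E)%E).
  apply: ereal_inf_lbound; apply: len.
  - by rewrite g' => t; exact: cst_continuous.
  - by move=> t /segK[].
  - by rewrite /g scale0r addr0 chart_mapK'.
  - by rewrite /g scale1r addrC subrK chart_mapK'.
apply: (integral_speed_le ac dg).
- by rewrite g' => t; exact: cst_continuous.
- by move=> t /segK[].
- by rewrite g' => t /segK[].
Qed.

Lemma cball_near_diag (e : R) : 0 < e ->
  near_diag (fun p q => riemannian_cball G p e q).
Proof.
move=> e0 x; have [c ac cx] := atlas_cover G x.
set u0 := chart_map c x.
have cu0 : chart_cod c u0 by exact: chart_cod_map.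
pose K := `|metric G c u0| + 1.
have K0 : 0 < K by rewrite ltr_wpDl.
have [r0 r00 r0P] : exists2 r, 0 < r & forall u, `|u - u0| <= r ->
    chart_cod c u /\ `|metric G c u| <= K.
  have : nbhs u0 (chart_cod c `&` [set u | `|metric G c u| <= K]).
    apply: filterI; first exact: nbhs_chart_cod.
    have /cvgrPdist_le/(_ 1 ltr01) := metric_cvg ac cu0.
    apply: filterS => u /= uu0.
    rewrite -[metric G c u](subrK (metric G c u0)).
    by apply: le_trans (ler_normD _ _) _; rewrite addrC lerD2l distrC.
  move=> /nbhs_ballP[r /= rpos rP]; exists (r / 2); first by rewrite divr_gt0.
  move=> u ur; apply: rP; rewrite -ball_normE /= distrC.
  by apply: le_lt_trans ur _; rewrite ltr_pdivrMr// ltr_pMr// ltr1n.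
(* The squared speed of the segment is at most [(C - 1) * r ^+ 2], hence at most [(C * r) ^+ 2], and
   [r] is taken below [e / C]. *)
pose C := (d * d)%:R * (K * 4) + 1.
have C1 : 1 <= C by rewrite lerDr mulr_ge0// mulr_ge0// ltW.
pose r := Num.min r0 (e / C).
have rpos : 0 < r by rewrite lt_min r00 divr_gt0// (lt_le_trans ltr01).
exists [set p | chart_dom c p /\ `|chart_map c p - u0| <= r].
  exact: chart_near_ball.
move=> p q [cp pr] [cq qr].
apply: (riemannian_dist_segment ac cp cq) => t t01 /=.
set w := chart_map c q - chart_map c p.
have wr : `|w| <= 2 * r.
  have -> : w = (chart_map c q - u0) - (chart_map c p - u0).
    by rewrite /w opprB addrA subrK.
  by apply: le_trans (ler_normB _ _) _; rewrite mulr_natl mulr2n lerD.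
have [cu uK] : chart_cod c (chart_map c p + t *: w) /\
    `|metric G c (chart_map c p + t *: w)| <= K.
  apply: r0P; apply: (@le_trans _ _ r); last by rewrite ge_min lexx.
  have -> : chart_map c p + t *: w - u0 =
      (1 - t) *: (chart_map c p - u0) + t *: (chart_map c q - u0).
    by rewrite /w; apply/rowP => i; rewrite !mxE; ring.
  move: t01 => /andP[t0 t1].
  apply: le_trans (ler_normD _ _) _.
  rewrite !normrZ (ger0_norm t0) ger0_norm ?subr_ge0//.
  have : (1 - t) * `|chart_map c p - u0| <= (1 - t) * r.
    by rewrite ler_wpM2l// subr_ge0.
  have : t * `|chart_map c q - u0| <= t * r by rewrite ler_wpM2l.
  lra.
split => //.
rewrite -(@ler_pXn2r _ 2)// ?nnegrE ?sqrtr_ge0 ?(ltW e0)//.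
rewrite tangent_norm_sqr//; apply: le_trans (ler_norm _) _.
apply: le_trans (gram_bound _ _ _) _.
apply: (@le_trans _ _ ((d * d)%:R * (K * (2 * r) * (2 * r)))).
  rewrite ler_wpM2l// ler_pM// ?mulr_ge0//.
  by rewrite ler_pM.
have -> : (d * d)%:R * (K * (2 * r) * (2 * r)) = (C - 1) * r ^+ 2.
  by rewrite /C; ring.
apply: (@le_trans _ _ ((C * r) ^+ 2)).
  rewrite exprMn ler_wpM2r ?sqr_ge0//.
  nra.
have rC : r <= e / C by rewrite ge_min lexx orbT.
have C0 : 0 < C by exact: lt_le_trans ltr01 C1.
have Cr0 : 0 <= C * r by rewrite mulr_ge0 ?ltW.
rewrite ler_pXn2r ?nnegrE//; last exact: ltW.
by rewrite mulrC -ler_pdivlMr.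
Qed.

End riemannian.

(** * Bump functions *)

Lemma is_derive_quadratic (R : realType) (F : R -> R) (x D : R) :
  (forall h, `|F (x + h) - F x - D * h| <= h ^+ 2) -> is_derive x 1 F D.
Proof.
move=> FD; suff cD : (fun h => h^-1 *: ((F \o shift x) (h *: 1) - F x)) @ 0^' --> D.
  by split; [apply/cvg_ex; exists D|apply: cvg_lim].
apply/cvgrPdist_le => e e0; near=> h.
have h0 : h != 0 by near: h; exact: nbhs_dnbhs_neq.
rewrite /= [h *: 1]mulr1 [h + x]addrC.
have -> : D - h^-1 *: (F (x + h) - F x) = - h^-1 * (F (x + h) - F x - D * h).
  by rewrite /GRing.scale/=; field.
rewrite normrM normrN normfV mulrC ler_pdivrMr ?normr_gt0//.
apply: le_trans (FD h) _.
rewrite -real_normK ?num_real// expr2 ler_wpM2r//; near: h.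
exact: dnbhs0_le.
Unshelve. all: by end_near. Qed.

Lemma is_derive_posX2 (R : realType) (x : R) :
  is_derive x 1 (fun x : R => Num.max 0 x ^+ 2) (2 * Num.max 0 x).
Proof.
apply: is_derive_quadratic => h.
rewrite ler_norml.
by case: (leP 0 x) => ?; case: (leP 0 (x + h)) => ?; apply/andP; split; nra.
Qed.

Section bump.
Context (R : realType) (d : nat) (u0 : 'rV[R]_d) (r : R) (r0 : 0 < r).

(** The sum is the squared Euclidean distance, whereas the norm of row vectors is the sup norm.
    Squaring the positive part makes it differentiable at its corner. *)
Definition bump (u : 'rV[R]_d) : R :=
  Num.max 0 (r ^+ 2 - \sum_(i < d) (u 0 i - u0 0 i) ^+ 2) ^+ 2.

Lemma bump_ge0 u : 0 <= bump u. Proof. exact: sqr_ge0. Qed.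

Lemma bump_gt0 u : 0 < bump u -> `|u - u0| <= r.
Proof.
rewrite /bump; set q := _ - _; have [le0|gt0 _] := leP q 0.
  by rewrite expr0n ltxx.
apply/ler_mx_normP; split; first exact: ltW.
move=> i j; rewrite (ord1 i) !mxE -(@ler_pXn2r _ 2)// ?nnegrE ?(ltW r0)//.
rewrite real_normK ?num_real//.
apply: (@le_trans _ _ (\sum_(i < d) (u 0 i - u0 0 i) ^+ 2)).
  by rewrite (bigD1 j)//= lerDl sumr_ge0// => k _; exact: sqr_ge0.
by rewrite -subr_ge0 ltW.
Qed.

Lemma bump_large u : `|u - u0| <= r / d.+1%:R -> r ^+ 4 / 2 <= bump u.
Proof.
move=> ur; have d0 : 0 < d.+1%:R :> R by [].
(* Because [(d - 1) ^ 2 >= 0], the quotient [d / (d + 1) ^ 2] is at most 1/4. *)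
have sum_le : \sum_(i < d) (u 0 i - u0 0 i) ^+ 2 <= r ^+ 2 / 4.
  apply: (@le_trans _ _ (\sum_(i < d) (r / d.+1%:R) ^+ 2)).
    apply: ler_sum => i _; rewrite -[leLHS]real_normK ?num_real//.
    rewrite ler_pXn2r ?nnegrE ?divr_ge0 ?(ltW r0)//.
    by apply: le_trans ur; have := ler_coord_norm (u - u0) 0 i; rewrite !mxE.
  rewrite sumr_const card_ord -[_ *+ d]mulr_natr expr_div_n -mulrA ler_wpM2l ?sqr_ge0//.
  rewrite ler_pdivrMl ?exprn_gt0// -natr1.
  have : 0 <= (d%:R - 1 : R) ^+ 2 by exact: sqr_ge0.
  by lra.
have r20 : 0 < r ^+ 2 by rewrite exprn_gt0.
rewrite /bump max_r; last by lra.
have : 3 / 4 * r ^+ 2 <= r ^+ 2 - \sum_(i < d) (u 0 i - u0 0 i) ^+ 2 by lra.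
move: (_ - _) => z zr.
have -> : r ^+ 4 = (r ^+ 2) ^+ 2 by rewrite -exprM.
move: (r ^+ 2) r20 zr => s s0 sz; nra.
Qed.

(** The derivative is twice the positive part, at most [r ^+ 2], times a factor bounded in the ball
    by [2 d r] times the speed; beyond the ball the positive part vanishes. *)
Lemma bump_derive (psi : R -> 'rV[R]_d) (t : R) : derivable psi t 1 ->
  derivable (bump \o psi) t 1 /\
  `|derive1 (bump \o psi) t| <= 4 * d%:R * r ^+ 3 * `|derive1 psi t| /\
  (r < `|psi t - u0| -> derive1 (bump \o psi) t = 0).
Proof.
move=> dpsi; set w := derive1 psi t.
have dcoord (i : 'I_d) : is_derive t 1 (fun s => psi s 0 i) (w 0 i).
  rewrite /w derive1E derive_mx// mxE.
  by apply: derivableP; move/derivable_mxP: dpsi; apply.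
pose q (s : R) := r ^+ 2 - \sum_(i < d) (psi s 0 i - u0 0 i) ^+ 2.
pose q' := - \sum_(i < d) 2 * (psi t 0 i - u0 0 i) * w 0 i.
have dq : is_derive t 1 q q'.
  rewrite /q; have -> : (fun s => r ^+ 2 - \sum_(i < d) (psi s 0 i - u0 0 i) ^+ 2) =
     cst (r ^+ 2) - \sum_(i < d) ((fun s => psi s 0 i) - cst (u0 0 i)) ^+ 2.
    by apply/funext => s; rewrite !fctE/= fct_sumE; congr (_ - _); apply: eq_bigr.
  apply: is_derive_eq.
  rewrite sub0r /q'; congr (- _); apply: eq_bigr => i _.
  by rewrite subr0 expr1 /GRing.scale/=.
have dphi : is_derive t 1 (bump \o psi) (2 * Num.max 0 (q t) * q').
  have -> : bump \o psi = (fun x : R => Num.max 0 x ^+ 2) \o q by [].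
  exact: (is_derive1_comp (is_derive_posX2 (q t)) dq).
have D1 : derive1 (bump \o psi) t = 2 * Num.max 0 (q t) * q'.
  by rewrite derive1E derive_val.
split; first exact: ex_derive.
have out : r < `|psi t - u0| -> derive1 (bump \o psi) t = 0.
  move=> rpsi; suff m0 : Num.max 0 (q t) = 0 by rewrite D1 m0 mulr0 mul0r.
  apply: max_l; rewrite leNgt; apply/negP => q0.
  have : 0 < bump (psi t) by rewrite /bump -/(q t) exprn_gt0// lt_max q0 orbT.
  by move=> /bump_gt0; rewrite leNgt rpsi.
split => //; have [psir|/out ->] := leP `|psi t - u0| r; last first.
  by rewrite normr0 mulr_ge0// mulr_ge0 ?exprn_ge0 ?(ltW r0)// mulr_ge0.
rewrite D1 !normrM ger0_norm// ger0_norm ?le_max ?lexx//.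
have q'le : `|q'| <= 2 * d%:R * r * `|w|.
  rewrite normrN; apply: le_trans (ler_norm_sum _ _ _) _.
  apply: (@le_trans _ _ (\sum_(i < d) 2 * r * `|w|)).
    apply: ler_sum => i _; rewrite !normrM ger0_norm//.
    rewrite ler_pM ?mulr_ge0 ?ler_coord_norm// ler_wpM2l//.
    by apply: le_trans psir; have := ler_coord_norm (psi t - u0) 0 i; rewrite !mxE.
  by rewrite sumr_const card_ord -[leLHS]mulr_natr; lra.
have mle : Num.max 0 (q t) <= r ^+ 2.
  rewrite ge_max sqr_ge0 /q lerBlDr lerDl sumr_ge0// => i _; exact: sqr_ge0.
apply: (@le_trans _ _ (2 * r ^+ 2 * (2 * d%:R * r * `|w|))); last first.
  by rewrite le_eqVlt; apply/orP; left; apply/eqP; ring.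
by rewrite ler_pM ?mulr_ge0 ?le_max ?lexx// ler_wpM2l.
Qed.

End bump.

(** * Small balls are small *)

Lemma derive1_comp_diff (R : realType) (V W : normedModType R)
    (F : V -> W) (g : R -> V) t :
  differentiable g t -> differentiable F (g t) ->
  derive1 (F \o g) t = 'd F (g t) (derive1 g t).
Proof.
move=> dg dF; rewrite [LHS]derive1E'; last exact: differentiable_comp.
by rewrite (diff_comp dg dF)/= derive1E'.
Qed.

Lemma is_derive_scale (R : realType) (k : R) (F : R -> R) t :
  derivable F t 1 -> is_derive t 1 (fun s => k * F s) (k * derive1 F t).
Proof.
by move=> dF; rewrite derive1E; exact: (is_deriveZ k (derivableP dF)).
Qed.

Section riemannian_balls.
Context (R : realType) (d : nat) (M : topologicalType).
Context (G : riemannian_manifold R d M).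
Implicit Types (c : chart R d M) (x p q : M) (u v : 'rV[R]_d).

Lemma metric_near c u (e : R) : atlas G c -> chart_cod c u -> 0 < e ->
  \forall u' \near u, chart_cod c u' /\ `|metric G c u' - metric G c u| <= e.
Proof.
move=> ac cu e0; apply: filterI; first exact: nbhs_chart_cod.
have /cvgrPdist_le/(_ e e0) := metric_cvg ac cu.
by apply: filterS => u' /=; rewrite distrC.
Qed.

Lemma gram_coercive_near c u : atlas G c -> chart_cod c u ->
  exists2 m, 0 < m & \forall u' \near u,
    chart_cod c u' /\ forall v, m * `|v| ^+ 2 <= gram (metric G c u') v v.
Proof.
move=> ac cu.
have [m m0 mu] := gram_coercive (fun v => metric_pos (v := v) ac cu).
exists (m / 2); first by rewrite divr_gt0.
pose D : R := (d * d)%:R + 1; have D0 : 0 < D by rewrite ltr_wpDl.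
have := metric_near ac cu (divr_gt0 (divr_gt0 m0 (ltr0n R 2)) D0).
apply: filterS => u' [cu' u'm]; split=> // v.
have := gram_perturb (metric G c u') (metric G c u) v v.
rewrite subrr normr0 mulr0 mul0r addr0 ler_norml => /andP[+ _].
have : (d * d)%:R * (`|metric G c u' - metric G c u| * `|v| ^+ 2) <=
    m / 2 * `|v| ^+ 2.
  rewrite mulrA ler_wpM2r ?sqr_ge0//.
  apply: (@le_trans _ _ (D * (m / 2 / D))); last by rewrite mulrC divfK ?gt_eqF.
  by rewrite ler_pM// lerDl.
have := mu v; lra.
Qed.

Lemma tangent_norm_ge c u v (m : R) : atlas G c -> chart_cod c u -> 0 <= m ->
  m * `|v| ^+ 2 <= gram (metric G c u) v v ->
  Num.sqrt m * `|v| <= tangent_norm G c u v.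
Proof.
move=> ac cu m0 mv.
rewrite -(@ler_pXn2r _ 2)// ?nnegrE ?mulr_ge0 ?sqrtr_ge0//.
by rewrite tangent_norm_sqr// exprMn sqr_sqrtr.
Qed.

Lemma differentiable_transition c c' u : atlas G c -> atlas G c' ->
  loc_dom id c c' u -> differentiable (loc_rep id c c') u.
Proof. by move=> ac ac' cu; have [+ _] := atlas_smooth ac ac' 1; exact. Qed.

Lemma loc_dom_inv (f : M -> M) c c' u : chart_cod c u ->
  chart_dom c' (f (chart_inv c u)) -> loc_dom f c c' u.
Proof.
move=> [x cx <-]; rewrite chart_mapK'// => fx; exists x => //.
Qed.

(** Closed in the whole of [M], as a compact subset of a Hausdorff space. This allows bumps to be
    extended by 0 outside the chart. *)
Lemma closed_ball_chart c u0 (r : R) :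
  (forall u, `|u - u0| <= r -> chart_cod c u) ->
  closed (chart_inv c @` [set u | `|u - u0| <= r]).
Proof.
move=> rc; apply: compact_closed; first exact: manifold_hausdorff G.
apply: continuous_compact.
  apply: continuous_in_subspaceT => u; rewrite inE => /rc; exact: chart_inv_cvg.
apply: bounded_closed_compact.
  exists (`|u0| + r); split; first exact: num_real.
  move=> K rK u /= ur; apply/ltW/(le_lt_trans _ rK).
  have := ler_normD u0 (u - u0); rewrite addrC subrK => /le_trans; apply.
  by rewrite lerD2l.
have -> : [set u | `|u - u0| <= r] =
  (fun u => `|u - u0|) @^-1` [set s : R | s <= r] by [].
apply: closed_comp; last exact: closed_le.
move=> u _; apply: (@continuous_comp _ _ _ (fun u => u - u0)
  (fun v : 'rV[R]_d => `|v|)); last exact: norm_continuous.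
exact: (cvgB cvg_id (cvg_cst u0)).
Qed.

(* A bump function, suitably scaled, has gradient at most 1, so its variation
   along a curve is at most the length of the curve. *)
Section bump_in_chart.
Context (c0 : chart R d M) (u0 : 'rV[R]_d) (r m : R).
Context (ac0 : atlas G c0) (r0 : 0 < r) (m0 : 0 < m).
Context (rc0 : forall u, `|u - u0| <= r -> chart_cod c0 u /\
  forall v, m * `|v| ^+ 2 <= gram (metric G c0 u) v v).

Definition chart_bump p : R :=
  if `[< chart_dom c0 p >] then bump u0 r (chart_map c0 p) else 0.

(** [Num.sqrt m] compares coordinate norms with Riemannian norms; the denominator dominates the
    slope given by [bump_derive], and the added 1 keeps it positive. *)
Definition bump_slope : R := Num.sqrt m / (4 * d%:R * r ^+ 3 + 1).

Let slope_den : 0 < 4 * d%:R * r ^+ 3 + 1.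
Proof.
apply: ltr_wpDl => //; apply: mulr_ge0; first exact: mulr_ge0.
exact/exprn_ge0/ltW.
Qed.

Lemma bump_slope_gt0 : 0 < bump_slope.
Proof. by apply: divr_gt0; rewrite ?sqrtr_gt0. Qed.

Lemma bump_slope_le (D w : R) : 0 <= w -> `|D| <= 4 * d%:R * r ^+ 3 * w ->
  - (bump_slope * D) <= Num.sqrt m * w.
Proof.
move=> w0 Dw; have k0 := bump_slope_gt0.
have -> : Num.sqrt m * w = bump_slope * ((4 * d%:R * r ^+ 3 + 1) * w).
  by rewrite mulrA /bump_slope divfK// gt_eqF.
rewrite -mulrN ler_pM2l//; apply: le_trans (ler_norm _) _; rewrite normrN.
by apply: le_trans Dw _; rewrite ler_wpM2r// lerDl.
Qed.

Lemma chart_bump_gt0 p : 0 < chart_bump p ->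
  chart_dom c0 p /\ `|chart_map c0 p - u0| <= r.
Proof.
rewrite /chart_bump; case: asboolP => [cp /(bump_gt0 r0)//|_].
by rewrite ltxx.
Qed.

Lemma chart_bump_speed c (g : R -> 'rV[R]_d) t : atlas G c ->
  (forall t, derivable g t 1) -> chart_cod c (g t) ->
  let phi s := bump_slope * chart_bump (chart_inv c (g s)) in
  derivable phi t 1 /\
  - derive1 phi t <= tangent_norm G c (g t) (derive1 g t).
Proof.
move=> ac dg ct phi; set p := chart_inv c (g t).
have cg : {for t, continuous g}.
  exact/differentiable_continuous/derivable1_diffP.
have cig : {for t, continuous (chart_inv c \o g)}.
  exact: continuous_comp cg (chart_inv_cvg ct).
have [c0p|nc0p] := pselect (chart_dom c0 p); last first.
  have phi0 : \forall s \near t, cst 0 s = phi s.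
    have nK : nbhs p (~` (chart_inv c0 @` [set u | `|u - u0| <= r])).
      apply: open_nbhs_nbhs; split.
        by apply: closed_openC; apply: closed_ball_chart => u /rc0[].
      by move=> [u /rc0[/chart_dom_inv c0u _] up]; apply: nc0p; rewrite -up.
    have : nbhs t ((chart_inv c \o g) @^-1`
      (~` (chart_inv c0 @` [set u | `|u - u0| <= r]))) by exact: cig.
    apply: filterS => s /= nball; apply/eqP.
    rewrite eq_sym mulf_eq0 orbC [chart_bump _ == 0]eq_sym.
    apply/orP; left; apply: contrapT => b0; apply: nball.
    have : 0 < chart_bump (chart_inv c (g s)).
      rewrite lt_neqAle; apply/andP; split; first exact/negP.
      by rewrite /chart_bump; case: ifP => // _; exact: bump_ge0.
    move=> /chart_bump_gt0[c0s sr].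
    by exists (chart_map c0 (chart_inv c (g s))) => //; rewrite chart_mapK'.
  have [dphi phi'] := near_eq_is_derive phi0 (is_derive_cst 0 t 1).
  by split=> //; rewrite derive1E phi' oppr0 sqrtr_ge0.
have ld : loc_dom id c c0 (g t) by exact: loc_dom_inv.
pose psi := loc_rep id c c0 \o g.
have dgt : differentiable g t by exact/derivable1_diffP.
have dloc : differentiable (loc_rep id c c0) (g t).
  exact: differentiable_transition.
have dpsi : differentiable psi t by exact: differentiable_comp.
have Dpsi : derive1 psi t = 'd (loc_rep id c c0) (g t) (derive1 g t).
  exact: derive1_comp_diff.
have speedE : tangent_norm G c (g t) (derive1 g t) =
    tangent_norm G c0 (psi t) (derive1 psi t).
  by rewrite /tangent_norm Dpsi metric_compat.
have [db [bK b0]] := bump_derive u0 r0 (iffRL (derivable1_diffP _ _) dpsi).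
have phiE : \forall s \near t, bump_slope * (bump u0 r \o psi) s = phi s.
  have : nbhs t ((chart_inv c \o g) @^-1` chart_dom c0).
    by apply: cig; exact: nbhs_chart_dom.
  apply: filterS => s c0s; rewrite /phi /chart_bump asboolT//.
have [dphi phi'] := near_eq_is_derive phiE (is_derive_scale bump_slope db).
split; first exact: dphi.
rewrite derive1E phi' speedE.
have [psir|/b0 ->] := leP `|psi t - u0| r; last first.
  by rewrite mulr0 oppr0 sqrtr_ge0.
have [c0t coer] := rc0 psir.
apply: le_trans _ (tangent_norm_ge ac0 c0t (ltW m0) (coer _)).
exact: bump_slope_le (normr_ge0 _) bK.
Qed.

Lemma chart_bump_curve x y L : curve_length G x y L ->
  ((bump_slope * (chart_bump x - chart_bump y))%:E <= L)%E.
Proof.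
elim=> [z|{}x {}y z c g {}L ac dg cdg cg gx gy _ IH].
  by rewrite subrr mulr0.
have -> : bump_slope * (chart_bump x - chart_bump z) =
  bump_slope * (chart_bump x - chart_bump y) +
  bump_slope * (chart_bump y - chart_bump z) by ring.
rewrite EFinD; apply: leeD IH; rewrite mulrBr -gx -gy.
apply: (@le_integral_derive _ _
  (fun t => bump_slope * chart_bump (chart_inv c (g t)))) => t t01.
- by apply: speed_continuous => //; exact: cg.
- by have [] := chart_bump_speed ac dg (cg t t01).
- by have [] := chart_bump_speed ac dg (cg t t01).
Qed.

Lemma chart_bump_cball p q (e : R) : riemannian_cball G p e q ->
  bump_slope * (chart_bump p - chart_bump q) <= e.
Proof.
move=> pq; rewrite -lee_fin; apply: le_trans pq.
by apply: le_ereal_inf_tmp => L; exact: chart_bump_curve.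
Qed.

End bump_in_chart.

(** Near [x] the bump is at least [r ^+ 4 / 2], and within Riemannian distance [k * (r ^+ 4 / 4)] it
    loses at most [r ^+ 4 / 4]: it stays positive, which confines [q] to the chart ball. *)
Lemma cball_small x N : nbhs x N -> exists N' e,
  [/\ nbhs x N', 0 < e & forall p, N' p -> riemannian_cball G p e `<=` N].
Proof.
move=> xN; have [c ac cx] := atlas_cover G x.
set u0 := chart_map c x.
have [m m0 /nbhs_ballP[r1 /= r10 r1P]] :=
  gram_coercive_near ac (chart_cod_map cx).
have [r2 r20 r2P] := chart_ball_sub cx xN.
pose r := Num.min (r1 / 2) r2.
have r0 : 0 < r by rewrite lt_min r20 divr_gt0.
have rc u : `|u - u0| <= r -> chart_cod c u /\
    forall v, m * `|v| ^+ 2 <= gram (metric G c u) v v.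
  move=> ur; apply: r1P; rewrite -ball_normE/= distrC; apply: le_lt_trans ur _.
  by rewrite gt_min ltr_pdivrMr// ltr_pMr// ltr1n.
pose k := bump_slope r m; have k0 : 0 < k by exact: bump_slope_gt0.
exists [set p | chart_dom c p /\ `|chart_map c p - u0| <= r / d.+1%:R].
exists (k * (r ^+ 4 / 4)); split.
- by apply: chart_near_ball => //; rewrite divr_gt0.
- by rewrite mulr_gt0// divr_gt0// exprn_gt0.
- move=> p [cp pr] q /(chart_bump_cball ac r0 m0 rc).
  rewrite -/k ler_pM2l// => pq.
  have : 0 < chart_bump c u0 r q.
    have := bump_large r0 pr; have : 0 < r ^+ 4 by rewrite exprn_gt0.
    by move: pq; rewrite {1}/chart_bump; case: asboolP => // _; lra.
  move=> /(chart_bump_gt0 r0)[cq qr].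
  have [] := r2P (chart_map c q); last by rewrite chart_mapK'.
  by apply: le_trans qr _; rewrite ge_min lexx orbT.
Qed.

End riemannian_balls.

(** * Local expansion in coordinates *)

Section local_expansion.
Context (R : realType) (d : nat).
Implicit Types (A B : 'M[R]_d) (w L D : 'rV[R]_d).

(** Stability of linear expansion: lowering the factor from [s] to [mu] pays for replacing the
    linear image [L] by the true displacement [D] and for moving the metrics. *)
Lemma gram_expand_perturb A0 B0 (m s mu CL : R) :
  0 < m -> 0 < mu -> mu < s -> 0 <= CL ->
  (forall w, m * `|w| ^+ 2 <= gram A0 w w) ->
  exists2 eta, 0 < eta & forall A B w L D,
    s * gram A0 w w <= gram B0 L L -> `|L| <= CL * `|w| ->
    `|D - L| <= eta * `|w| -> `|A - A0| <= eta -> `|B - B0| <= eta ->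
    mu * gram A w w <= gram B D D.
Proof.
move=> m0 mu0 mus CL0 A0m.
pose k : R := (d * d)%:R; have k0 : 0 <= k by [].
have nB0 : 0 <= `|B0| by [].
(* In units of the squared norm of [w], passing from [B0], [L] to [B], [D] costs [eta * E], passing
   from [A0] to [A] costs [eta * mu * k], and the margin is [(s - mu) * m]. *)
pose E := k * ((CL + 1) ^+ 2 + `|B0| * (2 * CL + 1)).
have E0 : 0 <= E by rewrite mulr_ge0// addr_ge0 ?sqr_ge0// mulr_ge0// addr_ge0// mulr_ge0.
pose Z := E + mu * k + 1.
have Z0 : 0 < Z by rewrite ltr_wpDl// addr_ge0// mulr_ge0// ltW.
pose eta := Num.min 1 ((s - mu) * m / Z).
have eta0 : 0 < eta by rewrite lt_min ltr01 divr_gt0// mulr_gt0// subr_gt0.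
have eta1 : eta <= 1 by rewrite ge_min lexx.
have etaZ : eta * (E + mu * k) <= (s - mu) * m.
  apply: (@le_trans _ _ (eta * Z)); first by rewrite ler_wpM2l ?(ltW eta0)// lerDl.
  by rewrite -ler_pdivlMr// ge_min lexx orbT.
exists eta => // A B w L D expL LCL DL AA0 BB0.
have nw : 0 <= `|w| by [].
have nD : `|D| <= (CL + 1) * `|w|.
  have := ler_normD (D - L) L; rewrite subrK.
  have : eta * `|w| <= 1 * `|w| by rewrite ler_wpM2r.
  lra.
have /ler_normlP[_ gA] := gram_perturb A A0 w w.
have /ler_normlP[gB _] := gram_perturb B B0 D L.
rewrite subrr normr0 mulr0 mul0r addr0 -/k in gA.
rewrite -/k in gB.
have eA : k * (`|A - A0| * `|w| ^+ 2) <= eta * k * `|w| ^+ 2.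
  by rewrite mulrA [eta * k]mulrC ler_wpM2r ?sqr_ge0// ler_wpM2l.
have eB : k * (`|B - B0| * `|D| ^+ 2 + `|B0| * `|D - L| * (`|D| + `|L|)) <=
    eta * E * `|w| ^+ 2.
  have -> : eta * E * `|w| ^+ 2 = k * (eta * ((CL + 1) * `|w|) ^+ 2 +
      `|B0| * (eta * `|w|) * ((CL + 1) * `|w| + CL * `|w|)) by rewrite /E; ring.
  rewrite ler_wpM2l// lerD//.
    apply: ler_pM; rewrite ?sqr_ge0//.
    by rewrite ler_pXn2r ?nnegrE// mulr_ge0// addr_ge0.
  apply: ler_pM; rewrite ?mulr_ge0 ?addr_ge0//; last exact: lerD.
  exact: ler_wpM2l.
have : mu * (gram A w w) <= mu * (gram A0 w w + eta * k * `|w| ^+ 2).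
  by rewrite ler_pM2l//; lra.
have : (s - mu) * (m * `|w| ^+ 2) <= (s - mu) * gram A0 w w.
  by rewrite ler_pM2l// subr_gt0.
have : eta * (E + mu * k) * `|w| ^+ 2 <= (s - mu) * m * `|w| ^+ 2.
  by rewrite ler_wpM2r// sqr_ge0.
lra.
Qed.

(* The mean value inequality, for [F] minus its differential at [u0]. *)
Lemma mean_value_diff (F : 'rV[R]_d -> 'rV[R]_d) (u0 : 'rV[R]_d) (rho eta : R) :
  (forall u, `|u - u0| <= rho -> differentiable F u) ->
  (forall u v, `|u - u0| <= rho -> `|'d F u v - 'd F u0 v| <= eta * `|v|) ->
  forall u v, `|u - u0| <= rho -> `|v - u0| <= rho ->
  `|F u - F v - 'd F u0 (u - v)| <= eta * `|u - v|.
Proof.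
move=> dF etaF u v ur vr; set w := u - v.
have [L LE] : exists L, L = 'd F u0 w by exists ('d F u0 w).
rewrite -LE.
pose g (t : R) := v + t *: w.
have gr (t : R) : 0 <= t <= 1 -> `|g t - u0| <= rho.
  move=> /andP[t0 t1].
  have -> : g t - u0 = (1 - t) *: (v - u0) + t *: (u - u0).
    by rewrite /g /w; apply/rowP => i; rewrite !mxE; ring.
  apply: le_trans (ler_normD _ _) _.
  rewrite !normrZ (ger0_norm t0) ger0_norm ?subr_ge0//.
  have : (1 - t) * `|v - u0| <= (1 - t) * rho by rewrite ler_wpM2l// subr_ge0.
  have : t * `|u - u0| <= t * rho by rewrite ler_wpM2l.
  lra.
have dg t : differentiable g t by exact: differentiable_line.
have dFg (t : R) : 0 <= t <= 1 -> derivable (F \o g) t 1.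
  by move=> /gr/dF dFt; apply/derivable1_diffP; exact: differentiable_comp.
have Fg' (t : R) : 0 <= t <= 1 -> derive1 (F \o g) t = 'd F (g t) w.
  move=> /gr/dF dFt; have gw : derive1 g t = w by exact: derive1_line.
  by rewrite -gw; exact: (derive1_comp_diff (dg t) dFt).
have eta_w : 0 <= eta * `|w|.
  by apply: le_trans (etaF u w ur).
apply/ler_mx_normP; split=> // i j; rewrite (ord1 i) {i}.
(* The norm being the sup of the coordinates, the scalar mean value theorem is applied to each of
   them. *)
pose phi (t : R) := (F (g t)) 0 j - t * L 0 j.
have dphi (t : R) : 0 <= t <= 1 -> is_derive t 1 phi (('d F (g t) w) 0 j - L 0 j).
  move=> t01.
  have dcoord : is_derive t 1 (fun s => (F \o g) s 0 j) (('d F (g t) w) 0 j).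
    rewrite -Fg'// derive1E derive_mx ?mxE; last exact: dFg.
    by apply: derivableP; have /derivable_mxP := dFg t t01; apply.
  have dlin : is_derive t 1 (fun s : R => s * L 0 j) (L 0 j).
    have := is_derive_scale (L 0 j) (@derivable_id R R t 1).
    rewrite derive1E derive_id mulr1.
    by under eq_fun do rewrite mulrC.
  exact: (is_deriveB dcoord dlin).
have cphi : {within `[0, 1], continuous phi}.
  apply: continuous_in_subspaceT => s; rewrite inE/= in_itv/= => s01.
  have [ds _] := dphi s s01.
  by apply: differentiable_continuous; apply/derivable1_diffP.
have dphi' (t : R) : t \in `]0, 1[ ->
    is_derive t 1 phi (('d F (g t) w) 0 j - L 0 j).
  by rewrite in_itv/= => /andP[t0 t1]; apply: dphi; rewrite !ltW.
have [t t01 phi01] := MVT_segment ler01 dphi' cphi.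
rewrite in_itv/= in t01.
have vw : v + w = u by rewrite /w addrC subrK.
have coordB (x y : 'rV[R]_d) : (x - y) 0 j = x 0 j - y 0 j by rewrite !mxE.
have phi10 : phi 1 - phi 0 = (F u - F v - L) 0 j.
  rewrite !coordB /phi /g scale1r scale0r addr0 vw mul1r mul0r subr0.
  by rewrite addrAC.
rewrite -phi10 phi01 subr0 mulr1 -coordB.
apply: le_trans (ler_coord_norm _ _ _) _; rewrite LE.
by apply: etaF; exact: gr.
Qed.

End local_expansion.

(** * The gauge *)

(* [compact_cover] of the library is stated for pointed spaces only. *)
Lemma compact_finite_cover (M : topologicalType) (N : M -> set M) :
  compact [set: M] -> (forall x, nbhs x (N x)) ->
  exists D : {fset M}, forall p : M, exists2 x, x \in D & nbhs p (N x).
Proof.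
move=> /compact_near_coveringP cM xN.
pose F := filter_from [set: {fset M}] (fun D0 => [set D | (D0 `<=` D)%fset]).
have FF : Filter F.
  apply: filter_from_filter; first by exists fset0.
  move=> D1 D2 _ _; exists (D1 `|` D2)%fset => // D /=.
  by rewrite fsubUset => /andP.
have [x _|D0 _ /(_ D0 (fsubset_refl D0)) D0P] :=
    cM _ F (fun D (p : M) => exists2 x, x \in D & nbhs p (N x)) FF.
  exists (interior (N x), [set D | ([fset x] `<=` D)%fset]) => /=.
    by split; [exact/nbhs_interior/xN|exists [fset x]%fset].
  move=> [p D] [/= pN xD]; exists x => //.
  by apply: (fsubsetP xD); rewrite fset11.
by exists D0 => p; exact: D0P.
Qed.

(** A substitute for the squared distance: the squared norm of the coordinate difference for the
    metric frozen at [p], hence not symmetric. *)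
Definition chart_gauge (R : realType) (d : nat) (M : topologicalType)
    (G : riemannian_manifold R d M) (c : chart R d M) (p q : M) : R :=
  gram (metric G c (chart_map c p)) (chart_map c p - chart_map c q)
    (chart_map c p - chart_map c q).

Section gauge.
Context (R : realType) (d : nat) (M : topologicalType).
Context (G : riemannian_manifold R d M).
Implicit Types (c : chart R d M) (x p q : M).

Lemma chart_gauge_refl c p : chart_gauge G c p p = 0.
Proof. by rewrite /chart_gauge subrr gram_0. Qed.

Lemma chart_gauge_sep c p q : atlas G c -> chart_dom c p -> chart_dom c q ->
  chart_gauge G c p q <= 0 -> p = q.
Proof.
move=> ac cp cq; have [pq _|pq] := eqVneq (chart_map c p) (chart_map c q).
  by rewrite -(chart_mapK' cp) pq chart_mapK'.
rewrite leNgt metric_pos// ?subr_eq0//; exact: chart_cod_map.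
Qed.

Lemma chart_gauge_near c x (e : R) : atlas G c -> chart_dom c x -> 0 < e ->
  nbhs (x, x) [set z | [/\ chart_dom c z.1, chart_dom c z.2 &
    chart_gauge G c z.1 z.2 <= e]].
Proof.
move=> ac cx e0.
have c1 : chart_map c z.1 @[z --> (x, x)] --> chart_map c x.
  exact: (cvg_comp fst (chart_map c) cvg_fst (chart_map_cvg cx)).
have c2 : chart_map c z.2 @[z --> (x, x)] --> chart_map c x.
  exact: (cvg_comp snd (chart_map c) cvg_snd (chart_map_cvg cx)).
have cm : metric G c (chart_map c z.1) @[z --> (x, x)] -->
    metric G c (chart_map c x).
  exact: (cvg_comp _ (metric G c) c1 (metric_cvg ac (chart_cod_map cx))).
have cg : chart_gauge G c z.1 z.2 @[z --> (x, x)] --> chart_gauge G c x x.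
  by apply: gram_cvg cm (cvgB c1 c2) (cvgB c1 c2).
rewrite chart_gauge_refl in cg.
have domx := nbhs_chart_dom cx.
have n12 : nbhs (x, x) [set z | chart_dom c z.1 /\ chart_dom c z.2].
  by exists (chart_dom c, chart_dom c).
have n3 : \forall z \near (x, x), chart_gauge G c z.1 z.2 <= e.
  exact: (cvgr_le _ cg).
by apply: filterS2 n12 n3 => z [].
Qed.

Lemma chart_gauge_small c x N : atlas G c -> chart_dom c x -> nbhs x N ->
  exists N' e, [/\ nbhs x N', 0 < e &
    forall p q, N' p -> chart_dom c q -> chart_gauge G c p q <= e -> N q].
Proof.
move=> ac cx xN; have [r r0 rN] := chart_ball_sub cx xN.
have [m m0 nm] := gram_coercive_near ac (chart_cod_map cx).
have r20 : 0 < r / 2 by rewrite divr_gt0.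
exists ([set p | chart_dom c p /\ `|chart_map c p - chart_map c x| <= r / 2] `&`
  chart_map c @^-1` [set u | chart_cod c u /\
    forall v, m * `|v| ^+ 2 <= gram (metric G c u) v v]).
exists (m * (r / 2) ^+ 2); split.
- by apply: filterI; [exact: chart_near_ball|exact: (chart_map_cvg cx)].
- by rewrite mulr_gt0// exprn_gt0.
- move=> p q [[cp pr] [_ coer]] cq pq.
  have := le_trans (coer _) pq.
  rewrite ler_pM2l// ler_pXn2r ?nnegrE ?(ltW r20)// => pqr.
  rewrite -(chart_mapK' cq); apply: (rN _ _).2.
  have -> : chart_map c q - chart_map c x =
      (chart_map c p - chart_map c x) - (chart_map c p - chart_map c q).
    by rewrite opprB [RHS]addrC addrA subrK.
  apply: le_trans (ler_normB _ _) _; lra.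
Qed.

(** [k p] is a chart whose closed piece contains [p]. The finitely many closed pieces that miss [x]
    also miss its nearby points, so for [p] near [x] the piece selected at [p] contains [x]. *)
Lemma chart_selector : compact [set: M] ->
  exists (I : finType) (S : I -> chart R d M) (k : M -> I),
  (forall i, atlas G (S i)) /\
  forall x, \forall p \near x,
    chart_dom (S (k p)) x /\ chart_dom (S (k p)) p.
Proof.
move=> cM.
have /choice[cK /all_and3[acK xK cKP]] x : exists cK : chart R d M * set M,
    [/\ atlas G cK.1, nbhs x cK.2 & closed cK.2 /\ cK.2 `<=` chart_dom cK.1].
  have [c ac cx] := atlas_cover G x.
  have [r r0 rP] := chart_ball_sub cx (nbhs_chart_dom cx).
  exists (c, chart_inv c @` [set u | `|u - chart_map c x| <= r]); split => //=.
  - apply: filterS (chart_near_ball cx r0) => p [cp pr].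
    by exists (chart_map c p) => //; rewrite chart_mapK'.
  - split; first by apply: (closed_ball_chart G) => u /rP[].
    by move=> _ [u /rP[_ cu] <-].
have [D cov] := compact_finite_cover cM xK.
have /choice[k kP] p : exists i : D, interior (cK (val i)).2 p.
  by have [x xD xp] := cov p; exists [` xD]%fset.
exists D, (fun i => (cK (val i)).1), k; split=> // x.
have near_cl (i : D) : \forall p \near x, (cK (val i)).2 p -> (cK (val i)).2 x.
  have [xi|nxi] := pselect ((cK (val i)).2 x); first exact: nearW.
  have : nbhs x (~` (cK (val i)).2).
    apply: open_nbhs_nbhs; split => //; apply: closed_openC.
    by have [] := cKP (val i).
  by apply: filterS => p np /np.
apply: filterS (filter_forall _ near_cl) => p clp.
have Kp : (cK (val (k p))).2 p := nbhs_singleton (kP p).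
by have [_ sub] := cKP (val (k p)); split; apply: sub => //; exact: clp.
Qed.

Lemma no_isolated_point x N : (0 < d)%N -> nbhs x N -> exists2 y, N y & y <> x.
Proof.
move=> d0 xN; have [c ac cx] := atlas_cover G x.
have [r r0 rN] := chart_ball_sub cx xN.
pose u := chart_map c x + const_mx r.
have ux : u - chart_map c x = const_mx r by rewrite /u addrC addKr.
have [cu Nu] : chart_cod c u /\ N (chart_inv c u).
  apply: rN; rewrite ux; apply/ler_mx_normP; split; first exact: ltW.
  by move=> i j; rewrite mxE gtr0_norm.
exists (chart_inv c u) => // /(congr1 (chart_map c)); rewrite chart_invK//.
move=> /eqP; rewrite -subr_eq0 ux => /eqP/matrixP/(_ 0 (Ordinal d0)).
by rewrite !mxE => /eqP; rewrite gt_eqF.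
Qed.

Context (f : M -> M) (theta s1 : R).
Context (cf : C1_map G f) (hf : holder_derivative G theta f) (theta0 : 0 < theta).
Context (s1_gt1 : 1 < s1).
Context (f_expand : forall c c' u (v : 'rV[R]_d), atlas G c -> atlas G c' ->
  loc_dom f c c' u -> s1 * tangent_norm G c u v <=
    tangent_norm G c' (loc_rep f c c' u) ('d (loc_rep f c c') u v)).

(** Gauges are squared norms, expanded by [s1 ^+ 2] at first order; the midpoint with 1 leaves a
    margin for the errors. *)
Definition expansion_rate : R := (1 + s1 ^+ 2) / 2.

Lemma expansion_rate_gt1 : 1 < expansion_rate.
Proof.
have : 1 < s1 ^+ 2 by rewrite exprn_egt1.
rewrite /expansion_rate; lra.
Qed.

Lemma near_loc_dom c c' u : loc_dom f c c' u ->
  nbhs u (loc_dom f c c').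
Proof.
move=> [x [cx cfx] <-].
have : nbhs (chart_map c x) (chart_cod c `&`
    chart_inv c @^-1` (f @^-1` chart_dom c')).
  apply: filterI; first exact/nbhs_chart_cod/chart_cod_map.
  apply: (chart_inv_cvg (chart_cod_map cx)); rewrite chart_mapK'//.
  by apply: cf.1; exact: nbhs_chart_dom.
by apply: filterS => v [cv fv]; exact: loc_dom_inv.
Qed.

(* The Hoelder condition gives the continuity of the derivative in operator
   norm. *)
Lemma near_diff c c' u (eta : R) : atlas G c -> atlas G c' ->
  loc_dom f c c' u -> 0 < eta ->
  \forall p \near u, loc_dom f c c' p /\
    forall v, `|'d (loc_rep f c c') p v - 'd (loc_rep f c c') u v| <= eta * `|v|.
Proof.
move=> ac ac' cu eta0; have [K [N [uN KN]]] := hf ac ac' cu.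
pose K' := `|K| + 1; have K'0 : 0 < K' by rewrite ltr_wpDl.
(* The radius at which [K'] times the power [theta] of [rho] equals [eta]. *)
pose rho := (eta / K') `^ theta^-1.
have rho0 : 0 < rho by rewrite powR_gt0// divr_gt0.
have near_u : \forall p \near u, `|p - u| <= rho.
  have /cvgrPdist_le/(_ rho rho0) := @cvg_id _ (nbhs u).
  by apply: filterS => p /=; rewrite distrC.
have Nu : N u by exact: nbhs_singleton.
apply: filterS3 (near_loc_dom cu) uN near_u => p cp Np pu; split => // v.
apply: le_trans (KN p u v Np Nu) _.
rewrite ler_wpM2r//; apply: (@le_trans _ _ (K' * rho `^ theta)).
  apply: (@le_trans _ _ (K' * `|p - u| `^ theta)).
    by rewrite ler_wpM2r ?powR_ge0// (le_trans (ler_norm K))// lerDl.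
  rewrite ler_pM2l//; apply: ge0_ler_powR; rewrite ?nnegrE//; exact: ltW.
rewrite /rho -powRrM mulVf ?gt_eqF// powRr1; last by apply: divr_ge0; exact: ltW.
by rewrite mulrC divfK// gt_eqF.
Qed.

(** The differential at [u0] expands squared norms by [s1 ^+ 2]; by the mean value inequality and
    the continuity of the metrics, the displacement of two nearby points is a perturbation of that
    linear case. *)
Lemma chart_gauge_expand c c' x : atlas G c -> atlas G c' ->
  chart_dom c x -> chart_dom c' (f x) ->
  nbhs (x, x) [set z |
    expansion_rate * chart_gauge G c z.1 z.2 <= chart_gauge G c' (f z.1) (f z.2)].
Proof.
move=> ac ac' cx cfx; set u0 := chart_map c x.
pose F := loc_rep f c c'.
have ld : loc_dom f c c' u0 by exists x.
have cu0 : chart_cod c u0 by exact: chart_cod_map.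
have FE p : chart_dom c p -> F (chart_map c p) = chart_map c' (f p).
  by move=> cp; rewrite /F /loc_rep chart_mapK'.
have Fcod : chart_cod c' (F u0) by rewrite FE//; exact: chart_cod_map.
have [m m0 A0m] := gram_coercive (fun v => metric_pos (v := v) ac cu0).
have dF u : loc_dom f c c' u -> differentiable F u.
  by have [_ /(_ c c' ac ac')[+ _]] := cf; apply.
have [CL CL0 LCL] := linear_lipschitz (diff_continuous (dF _ ld)).
have rate1 := expansion_rate_gt1.
have rate0 : 0 < expansion_rate by exact: lt_trans rate1.
have rates : expansion_rate < s1 ^+ 2.
  have : 1 < s1 ^+ 2 by rewrite exprn_egt1.
  rewrite /expansion_rate; lra.
have [eta eta0 etaP] := gram_expand_perturb (metric G c' (F u0)) m0 rate0 rates
  (ltW CL0) A0m.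
have nF : \forall p \near u0, `|metric G c' (F p) - metric G c' (F u0)| <= eta.
  have cF := differentiable_continuous (dF _ ld).
  have : nbhs u0 (F @^-1` [set v | chart_cod c' v /\
      `|metric G c' v - metric G c' (F u0)| <= eta]).
    by apply: cF; exact: metric_near.
  by apply: filterS => u [].
have [rho rho0 rhoP] : exists2 rho, 0 < rho & forall u, `|u - u0| <= rho ->
    [/\ loc_dom f c c' u /\
        forall v, `|'d F u v - 'd F u0 v| <= eta * `|v|,
        `|metric G c u - metric G c u0| <= eta &
        `|metric G c' (F u) - metric G c' (F u0)| <= eta].
  have nD := near_diff ac ac' ld eta0.
  have nM := metric_near ac cu0 eta0.
  have : nbhs u0 ([set u | loc_dom f c c' u /\
        forall v, `|'d F u v - 'd F u0 v| <= eta * `|v|] `&`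
      ([set u | chart_cod c u /\ `|metric G c u - metric G c u0| <= eta] `&`
       [set u | `|metric G c' (F u) - metric G c' (F u0)| <= eta])).
    by apply: filterI => //; exact: filterI.
  move=> /nbhs_ballP[r /= r0 rP]; exists (r / 2); first by rewrite divr_gt0.
  move=> u ur; have /rP[[ldu etau] [[_ Au] Bu]] : ball u0 r u.
    rewrite -ball_normE/= distrC; apply: le_lt_trans ur _.
    by rewrite ltr_pdivrMr// ltr_pMr// ltr1n.
  by split.
have near_x := chart_near_ball cx rho0.
exists ([set p | chart_dom c p /\ `|chart_map c p - u0| <= rho],
        [set p | chart_dom c p /\ `|chart_map c p - u0| <= rho]) => //.
move=> [p q] [/= [cp pr] [cq qr]].
rewrite /chart_gauge -!FE//.
have [_ Ap Bp] := rhoP _ pr.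
apply: (etaP _ _ _ ('d F u0 (chart_map c p - chart_map c q))) => //.
  rewrite -tangent_norm_sqr// -[leRHS]tangent_norm_sqr// -exprMn.
  rewrite ler_pXn2r ?nnegrE ?mulr_ge0 ?sqrtr_ge0 ?(ltW (lt_trans ltr01 s1_gt1))//.
  exact: f_expand.
apply: (mean_value_diff (rho := rho)) => //.
- by move=> u /rhoP[[/dF]].
- by move=> u v /rhoP[[_ +] _ _]; apply.
Qed.

End gauge.

(** * The gauge read in finitely many charts *)

Section expansion_gauge.
Context (R : realType) (d : nat) (M : topologicalType).
Context (G : riemannian_manifold R d M) (f : M -> M) (theta s1 : R).
Context (cM : compact [set: M]).
Context (cf : C1_map G f) (hf : holder_derivative G theta f) (theta0 : 0 < theta).
Context (s1_gt1 : 1 < s1).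
Context (f_expand : forall c c' u (v : 'rV[R]_d), atlas G c -> atlas G c' ->
  loc_dom f c c' u -> s1 * tangent_norm G c u v <=
    tangent_norm G c' (loc_rep f c c' u) ('d (loc_rep f c c') u v)).
Context (I : finType) (S : I -> chart R d M) (k : M -> I).
Context (aS : forall i, atlas G (S i)).
Context (kS : forall x, \forall p \near x,
  chart_dom (S (k p)) x /\ chart_dom (S (k p)) p).

(** The chart follows the first point and may jump with it, so local estimates are proved for all
    charts at once. *)
Definition gauge (p q : M) : R := chart_gauge G (S (k p)) p q.

Definition gauge_close (p q : M) : Prop :=
  [/\ chart_dom (S (k p)) p, chart_dom (S (k p)) q,
      expansion_rate s1 * gauge p q <= gauge (f p) (f q) & gauge p q <= 1].

Lemma gauge_small e : 0 < e -> near_diag (fun p q => gauge p q <= e).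
Proof.
move=> e0; apply: near_diagP => x.
have H (i : I) : \forall z \near (x, x), chart_dom (S i) x ->
    chart_gauge G (S i) z.1 z.2 <= e.
  have [ix|nix] := pselect (chart_dom (S i) x); last first.
    by apply: (filterS _ (@filterT _ (nbhs (x, x)) _)) => z _ /nix.
  by apply: filterS (chart_gauge_near (aS i) ix e0) => z [].
have H1 : \forall z \near (x, x), chart_dom (S (k z.1)) x.
  exists ([set p | chart_dom (S (k p)) x], setT) => /=.
    split; last exact: filterT.
    by apply: filterS (kS x) => p [].
  by move=> [p q] [].
apply: filterS2 (filter_forall _ H) H1 => z Hz; exact: Hz.
Qed.

(** There are finitely many pairs of charts: the estimates hold near [x] for all those around [x]
    and [f x], hence for the pair selected at [z.1] and [f z.1]. *)
Lemma near_diag_gauge_close : near_diag gauge_close.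
Proof.
apply: near_diagP => x.
have H (ij : I * I) : \forall z \near (x, x), chart_dom (S ij.1) x ->
    chart_dom (S ij.2) (f x) ->
    [/\ chart_dom (S ij.1) z.1, chart_dom (S ij.1) z.2,
    expansion_rate s1 * chart_gauge G (S ij.1) z.1 z.2 <=
      chart_gauge G (S ij.2) (f z.1) (f z.2) &
    chart_gauge G (S ij.1) z.1 z.2 <= 1].
  case: ij => i j /=.
  have [ix|nix] := pselect (chart_dom (S i) x); last first.
    by apply: (filterS _ (@filterT _ (nbhs (x, x)) _)) => z _ /nix.
  have [jx|njx] := pselect (chart_dom (S j) (f x)); last first.
    by apply: (filterS _ (@filterT _ (nbhs (x, x)) _)) => z _ _ /njx.
  have := chart_gauge_expand cf hf theta0 s1_gt1 f_expand (aS i) (aS j) ix jx.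
  by apply: filterS2 (chart_gauge_near (aS i) ix ltr01) => z [].
have H1 : \forall z \near (x, x), chart_dom (S (k z.1)) x /\
    chart_dom (S (k (f z.1))) (f x).
  exists ([set p | chart_dom (S (k p)) x /\ chart_dom (S (k (f p))) (f x)], setT).
    split; last exact: filterT.
    have := cf.1 x _ (kS (f x)); apply: filterS2 (kS x) => p [? _] [? _].
    by split.
  by move=> [p q] [].
by apply: filterS2 (filter_forall _ H) H1 => z Hz [z1 z2]; exact: (Hz (_, _)).
Qed.

Lemma gauge_close_small W : near_diag W ->
  exists2 e, 0 < e & forall p q, gauge_close p q -> gauge p q <= e -> W p q.
Proof.
move=> nW.
have [] := @compact_uniform R M cM
  (fun e p => forall q, gauge_close p q -> gauge p q <= e -> W p q).
- by move=> e e' p ee' H q pq pqe; apply: H => //; exact: le_trans ee'.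
- move=> x; have [N xN NW] := nW x.
  have /choice[Ne HNe] (i : I) : exists Ne : set M * R,
      [/\ nbhs x Ne.1, 0 < Ne.2 & chart_dom (S i) x ->
      forall p q, Ne.1 p -> chart_dom (S i) q ->
        chart_gauge G (S i) p q <= Ne.2 -> N q].
    have [ix|nix] := pselect (chart_dom (S i) x); last first.
      by exists (setT, 1); split => //=; exact: filterT.
    have [N' [e [xN' e0 N'e]]] := chart_gauge_small (aS i) ix xN.
    by exists (N', e).
  exists (N `&` [set p | chart_dom (S (k p)) x /\ forall i, (Ne i).1 p]).
  exists (\big[Num.min/1]_i (Ne i).2); split.
  + apply: filterI => //.
    have nNe (i : I) : nbhs x (Ne i).1 by have [] := HNe i.
    by apply: filterS2 (kS x) (filter_forall _ nNe) => p [].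
  + by apply: lt_bigmin => // i _; have [] := HNe i.
  + move=> p [Np [px pNe]] q [_ pq _ _] pqe; apply: NW => //.
    have [_ _ /(_ px p q (pNe _) pq)] := HNe (k p); apply.
    by apply: le_trans pqe _; exact: bigmin_le.
- by move=> e e0 H; exists e.
Qed.

Lemma gauge_close_sep p q : gauge_close p q -> gauge p q <= 0 -> p = q.
Proof. by move=> [pp pq _ _]; exact: chart_gauge_sep. Qed.

End expansion_gauge.

(** * The scale of the tilings and the conclusion *)

Theorem theorem1p4 (R : realType) (d : nat) (M : topologicalType)
    (G : riemannian_manifold R d M) (theta : R) (f : M -> M) :
  (0 < d)%N -> compact [set: M] ->
  0 < theta -> expanding_endomorphism G theta f ->
  exists2 eps0 : R, 0 < eps0 &
    forall (y : M) (eps : R), 0 < eps -> eps < eps0 ->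
    forall (T : tiling G f eps) (astar : nat),
      (0 < astar)%N -> descending T astar ->
      winning T astar (nondense_set f y).
Proof.
move=> d0 cM theta0 [cf hf [s1 [s2 [s1_gt1 _ f_exp]]]].
have f_expand c c' u (v : 'rV[R]_d) : atlas G c -> atlas G c' ->
    loc_dom f c c' u -> s1 * tangent_norm G c u v <=
    tangent_norm G c' (loc_rep f c c' u) ('d (loc_rep f c c') u v).
  by move=> ac ac' cu; have /andP[] := f_exp c c' u v ac ac' cu.
have hM := manifold_hausdorff G.
have [I [S [k [aS kS]]]] := chart_selector G cM.
pose V0 := gauge_close G f s1 S k; pose delta := gauge G S k.
have nV0 : near_diag V0.
  exact: (near_diag_gauge_close cf hf theta0 s1_gt1 f_expand aS kS).
have mu1 := expansion_rate_gt1 s1_gt1.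
have V0_expand p q : V0 p q ->
    expansion_rate s1 * delta p q <= delta (f p) (f q) by case.
have V0_le1 p q : V0 p q -> delta p q <= 1 by case.
have delta_refl p : delta p p = 0 by exact: chart_gauge_refl.
have V0_sep p q : V0 p q -> delta p q <= 0 -> p = q.
  exact: gauge_close_sep.
have V0_small W : near_diag W ->
    exists2 e, 0 < e & forall p q, V0 p q -> delta p q <= e -> W p q.
  exact: gauge_close_small.
have delta_small e : 0 < e -> near_diag (fun p q => delta p q <= e).
  exact: gauge_small.
have B_mono (p : M) (e e' : R) : e' <= e ->
    riemannian_cball G p e' `<=` riemannian_cball G p e.
  by move=> ee' q /= /le_trans; apply; rewrite lee_fin.
have B_small := cball_small G.
have B_large := cball_near_diag G.
have [V1 [nV1 sV1 V1V0 V1V0']] := near_diag_half3 cM B_mono B_small B_large nV0.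
have V1V0'' p q r : V1 p q -> V1 q r -> V0 p r.
  by move=> pq qr; apply: (V1V0' p q r r) => //; exact: near_diag_refl.
have [U nU UP] := small_image_shadow cf.1 mu1 nV0 V0_expand V0_small delta_small
  nV1 sV1 V1V0'' V1V0'.
(* Two [W]-steps through the center of the ball containing the image of an atom join any two points
   of that image within [U]; balls of radius [e0] are [W]-small. *)
have [W [nW sW WU]] := near_diag_half cM B_mono B_small B_large nU.
have [e0 e00 e0W] := near_diag_ball cM B_mono B_small nW.
exists e0 => // y eps eps0 epse0 T astar _ _.
apply: (winning_nondense_set (V0 := V0)) => //.
- exact: cf.1.
- by move=> x N; exact: (no_isolated_point G d0).
- by move=> n p q; exact: (shadow_inj mu1 V0_expand delta_refl V0_sep).
- by move=> W' nW'; exact: (shadow_small mu1 V0_expand V0_le1 V0_small).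
- by move=> p q; exact: (shadow_eq mu1 V0_expand V0_le1 V0_sep).
move=> n i p q n0; apply: UP; first exact: atom_connected.
have [x _ [_ sub]] := atom_ball i n0.
have close p' : atom i p' -> W (iter n f x) (iter n f p').
  by move=> ip'; apply: e0W; apply: (B_mono _ _ _ (ltW epse0)); apply: sub; exists p'.
by move=> p' q' ip' iq'; apply: (WU _ (iter n f x)); [apply: sW|]; exact: close.
Qed.
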